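(* Let $\alpha\in\mathbb{R}\setminus\mathbb{Q}$ with $0\le\beta(\alpha)<\infty$, let $\eta>C_1\beta(\alpha)$, let $f$ be real analytic on $\mathbb{R}/\mathbb{Z}$ and analytic on the strip $\Delta_{C_2\eta}$, and let $0<|\lambda|\le\lambda_0$, where $C_1,C_2$ and $\lambda_0=\lambda_0(f,\eta,\alpha)$ are as in the context. Then there is a constant $m_\star$ (depending on $\lambda,f,\alpha,\eta$) such that for every $m\in\mathbb{Z}\setminus\{0\}$ with $|m|\ge m_\star$, $$E_m^+-E_m^-\le e^{-\frac{\eta}{3}n},$$ where $n=n(E_m^+)$ is the resonance index associated with $E=E_m^+$.
   Context: $(H_{\lambda f,\alpha,\theta}x)_n=x_{n+1}+x_{n-1}+\lambda f(\theta+n\alpha)x_n$ on $\ell^2(\mathbb{Z})$, with $\theta$-independent spectrum $\Sigma_{\lambda f,\alpha}$. $\beta(\alpha)=\limsup_{k\to\infty}\frac{-\ln\|k\alpha\|_{\mathbb{R}/\mathbb{Z}}}{|k|}$, $\|x\|_{\mathbb{R}/\mathbb{Z}}=\min_{k\in\mathbb{Z}}|x-k|$. $\Delta_\delta=\{z\in\mathbb{C}/\mathbb{Z}:|\Im z|\le\delta\}$ and $\|v\|_\delta=\sup_{z\in\Delta_\delta}\|v(z)\|$. $S_{\lambda f,E}(x)=\begin{pmatrix}E-\lambda f(x)&-1\\1&0\end{pmatrix}$ and $A^E_k(x)=S_{\lambda f,E}(x+(k-1)\alpha)\cdots S_{\lambda f,E}(x)$. $\rho_{\lambda f,\alpha}(E)\in[0,\frac12]$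 is the fibered rotation number of the cocycle $(\alpha,S_{\lambda f,E})$, i.e. the average rotation (in units of $2\pi$) of directions under iteration of $(x,v)\mapsto(x+\alpha,S_{\lambda f,E}(x)v)$, normalized to be continuous and non-increasing in $E$ from $\frac12$ (for $E\le\min\Sigma_{\lambda f,\alpha}$) to $0$ (for $E\ge\max\Sigma_{\lambda f,\alpha}$); equivalently $1-2\rho_{\lambda f,\alpha}$ is the integrated density of states. For $m\ne0$, $[E_m^-,E_m^+]=\{E:2\rho_{\lambda f,\alpha}(E)=m\alpha\bmod\mathbb{Z}\}$. Dual operator: $(\widehat H_{\lambda f,\alpha,\theta}x)_n=\sum_{k}\lambda\widehat f_kx_{n-k}+2\cos(2\pi(\theta+n\alpha))x_n$, with $\widehat f_k$ the Fourier coefficients of $f$. For each $E\in\Sigma_{\lambda f,\alpha}$ there are (Avila–Jitomirskaya) $\theta(E)\in\mathbb{R}/\mathbb{Z}$ and a sequence $\widehat u$ with $\widehat u_0=1$, $|\widehat u_k|\le1$, $\widehat H_{\lambda f,\alpha,\theta(E)}\widehat u=E\widehat u$; fix such a choice for each $E$. The constants: $C_1,C_2$ are fixed sufficiently large absolute constants, and $\lambda_0=\lambda_0(f,\eta,\alpha)>0$ is a threshold for which the following known results (Liu–Yuan) hold whenever $0<|\lambda|\le\lambda_0$, $E\in\Sigma_{\lambda f,\alpha}$ and $2\rho_{\lambda f,\alpha}(E)=m\alpha\bmod\mathbb{Z}$: (a) there is $\widetilde n\in\mathbb{Z}$ with $2\theta(E)=\widetilde n\alpha\bmod\mathbb{Z}$;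 put $n=n(E)=|\widetilde n|$ (the resonance index); (b) $|m|\le Cn$ if $|m|$ is larger than a constant depending on $\lambda,f,\alpha$; (c) $|\widehat u_k|\le C_\star e^{-2\pi\eta|k|}$ for $|k|\ge3n$; (d) $\sup_{0\le k\le e^{\eta n}}\|A^E_k\|_\eta\le C_\star e^{C\beta(\alpha)n}$. Here $C$ is absolute and $C_\star$ depends on $\lambda,f,\alpha,\eta$ only. *)

(* Defs.v *)
From Stdlib Require Import Reals ZArith.
From Coquelicot Require Import Coquelicot.

Set Implicit Arguments.
Unset Strict Implicit.
Unset Printing Implicit Defensive.

Open Scope R_scope.

(** ** Arithmetic of the frequency *)

Definition irrational (alpha : R) : Prop :=
  forall p q : Z, q <> 0%Z -> alpha <> IZR p / IZR q.

(* Elements of R/Z are represented by real numbers. *)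
Definition eq_mod_Z (a b : R) : Prop := exists j : Z, a = b + IZR j.

Definition dist_to_Z (x : R) : R :=
  real (Glb_Rbar (fun r => exists k : Z, r = Rabs (x - IZR k))).

(* Only k >= 0 is needed, since k and -k give the same term. *)
Definition beta (alpha : R) : Rbar :=
  LimSup_seq (fun k : nat => - ln (dist_to_Z (INR k * alpha)) / INR k).

(** ** Analytic potentials and norms on strips *)

Definition in_strip (delta : R) (z : C) : Prop := Rabs (Im z) <= delta.

(* [F] is the extension of the real 1-periodic function [f] to the closed strip
   of half-width [delta]; analyticity on the closed strip means holomorphy in a
   neighbourhood of each of its points.  The values of [F] away from the strip
   are irrelevant. *)
Definition analytic_extension (delta : R) (f : R -> R) (F : C -> C) : Prop :=
  (forall x : R, F (RtoC x) = RtoC (f x)) /\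
  (forall z : C, in_strip delta z -> F (z + 1)%C = F z) /\
  (forall z : C, in_strip delta z ->
     locally z (fun w : C => ex_derive (K := C_AbsRing) (V := C_NormedModule) F w)).

Definition mat_vec (K : Ring) (M : @matrix K 2 2) (v : K * K) : K * K :=
  (plus (mult (coeff_mat zero M 0 0) (fst v)) (mult (coeff_mat zero M 0 1) (snd v)),
   plus (mult (coeff_mat zero M 1 0) (fst v)) (mult (coeff_mat zero M 1 1) (snd v))).

Definition vec_norm (v : C * C) : R := sqrt (Cmod (fst v) ^ 2 + Cmod (snd v) ^ 2).

Definition op_norm (M : @matrix C 2 2) : R :=
  real (Lub_Rbar (fun r => exists v : C * C,
    vec_norm v = 1 /\ r = vec_norm (mat_vec (K := C_Ring) M v))).

Definition strip_norm (delta : R) (A : C -> @matrix C 2 2) : Rbar :=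
  Lub_Rbar (fun r => exists z : C, in_strip delta z /\ r = op_norm (A z)).

(** ** Schroedinger cocycles *)

Definition step_matrix (K : Ring) (w : K) : @matrix K 2 2 :=
  [ [ w, opp one ], [ one, zero ] ].

Definition S_real (lambda : R) (f : R -> R) (E x : R) : @matrix R 2 2 :=
  step_matrix (K := R_Ring) (E - lambda * f x).

Definition S_cplx (lambda : R) (F : C -> C) (E : R) (z : C) : @matrix C 2 2 :=
  step_matrix (K := C_Ring) (RtoC E - RtoC lambda * F z)%C.

Fixpoint transfer (lambda : R) (F : C -> C) (alpha E : R) (k : nat) (z : C)
  : @matrix C 2 2 :=
  match k with
  | O => Mone (T := C_Ring)
  | S j => Mmult (T := C_Ring)
             (S_cplx lambda F E (z + RtoC (INR j * alpha))%C)
             (transfer lambda F alpha E j z)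
  end.

(** ** Fibered rotation number *)

Definition direction (y : R) : R * R := (cos (2 * PI * y), sin (2 * PI * y)).

(* [psi x y] is the angle, in units of 2 pi, by which [A x] turns the direction
   of angle [y]; two such lifts differ by an integer constant. *)
Definition is_angle_lift (A : R -> @matrix R 2 2) (psi : R -> R -> R) : Prop :=
  (forall p : R * R, continuous (fun q : R * R => psi (fst q) (snd q)) p) /\
  (forall x y : R, psi (x + 1) y = psi x y) /\
  (forall x y : R, psi x (y + 1) = psi x y) /\
  (forall x y : R, exists r : R, 0 < r /\
     mat_vec (K := R_Ring) (A x) (direction y) =
       (r * fst (direction (y + psi x y)), r * snd (direction (y + psi x y)))).

Fixpoint angle_orbit (alpha : R) (psi : R -> R -> R) (x y : R) (k : nat) : R :=
  match k with
  | O => y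
  | S j => angle_orbit alpha psi x y j
           + psi (x + INR j * alpha) (angle_orbit alpha psi x y j)
  end.

Definition is_rotation_number (alpha : R) (A : R -> @matrix R 2 2) (r : R) : Prop :=
  exists psi : R -> R -> R, is_angle_lift A psi /\
    forall x y : R,
      is_lim_seq (fun k : nat => (angle_orbit alpha psi x y k - y) / INR k) r.

(* The rotation number is defined modulo Z, and at most one of its
   representatives lies in [0, 1/2].  With the counterclockwise orientation used
   here this representative exists and decreases from 1/2 to 0 as [E] grows. *)
Definition rho (lambda : R) (f : R -> R) (alpha E : R) : R :=
  iota (fun r : R => 0 <= r <= 1 / 2 /\
    is_rotation_number alpha (S_real lambda f E) r).

Definition gap_energies (lambda : R) (f : R -> R) (alpha : R) (m : Z) (E : R) : Prop :=
  eq_mod_Z (2 * rho lambda f alpha E) (IZR m * alpha).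

Definition E_minus (lambda : R) (f : R -> R) (alpha : R) (m : Z) : R :=
  real (Glb_Rbar (gap_energies lambda f alpha m)).

Definition E_plus (lambda : R) (f : R -> R) (alpha : R) (m : Z) : R :=
  real (Lub_Rbar (gap_energies lambda f alpha m)).

(** ** The operator on l^2(Z) and its spectrum *)

Definition in_l2 (x : Z -> C) : Prop :=
  ex_series (fun k : nat => Cmod (x (Z.of_nat k)) ^ 2) /\
  ex_series (fun k : nat => Cmod (x (- Z.of_nat (S k))%Z) ^ 2).

Definition l2_norm (x : Z -> C) : R :=
  sqrt (Series (fun k : nat => Cmod (x (Z.of_nat k)) ^ 2) +
        Series (fun k : nat => Cmod (x (- Z.of_nat (S k))%Z) ^ 2)).

Definition schrodinger_op (lambda : R) (f : R -> R) (alpha theta : R) (x : Z -> C) (n : Z) : C :=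
  (x (n + 1)%Z + x (n - 1)%Z + RtoC (lambda * f (theta + IZR n * alpha)%R) * x n)%C.

(* [G] is a bounded two-sided inverse of T - z on l^2(Z); its linearity follows
   from that of [T]. *)
Definition in_resolvent_set (T : (Z -> C) -> Z -> C) (z : C) : Prop :=
  exists (G : (Z -> C) -> Z -> C) (K : R),
    (forall y : Z -> C, in_l2 y ->
       in_l2 (G y) /\ l2_norm (G y) <= K * l2_norm y /\
       forall n : Z, (T (G y) n - z * G y n)%C = y n) /\
    (forall x : Z -> C, in_l2 x ->
       forall n : Z, G (fun k : Z => (T x k - z * x k)%C) n = x n).

Definition in_spectrum (T : (Z -> C) -> Z -> C) (z : C) : Prop :=
  ~ in_resolvent_set T z.

(* For irrational [alpha] and continuous periodic [f] the spectrum is real and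
   does not depend on the phase. *)
Definition Sigma (lambda : R) (f : R -> R) (alpha : R) (E : R) : Prop :=
  forall theta : R, in_spectrum (schrodinger_op lambda f alpha theta) (RtoC E).

(** ** The dual operator *)

Definition cis (t : R) : C := (cos t, sin t).

Definition fourier (f : R -> R) (k : Z) : C :=
  RInt (V := C_R_CompleteNormedModule)
    (fun x : R => (RtoC (f x) * cis (- (2 * PI * IZR k * x)))%C) 0 1.

Definition is_seriesZ (a : Z -> C) (l : C) : Prop :=
  exists l1 l2 : C,
    is_series (K := C_AbsRing) (V := C_NormedModule)
      (fun k : nat => a (Z.of_nat k)) l1 /\
    is_series (K := C_AbsRing) (V := C_NormedModule)
      (fun k : nat => a (- Z.of_nat (S k))%Z) l2 /\
    l = (l1 + l2)%C.

(* The dual operator at phase [theta] maps the sequence [u] to [v]. *)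
Definition is_dual_image (lambda : R) (f : R -> R) (alpha theta : R)
    (u v : Z -> C) : Prop :=
  forall n : Z, exists s : C,
    is_seriesZ (fun k : Z => (RtoC lambda * fourier f k * u (n - k)%Z)%C) s /\
    v n = (s + RtoC (2 * cos (2 * PI * (theta + IZR n * alpha)))%R * u n)%C.

Definition is_dual_choice (lambda : R) (f : R -> R) (alpha : R)
    (theta : R -> R) (u : R -> Z -> C) : Prop :=
  forall E : R, Sigma lambda f alpha E ->
    u E 0%Z = RtoC 1 /\
    (forall k : Z, Cmod (u E k) <= 1) /\
    is_dual_image lambda f alpha (theta E) (u E)
      (fun n : Z => (RtoC E * u E n)%C).

(* For irrational [alpha] there is at most one such [n]. *)
Definition is_resonance_index (alpha theta : R) (n : nat) : Prop :=
  exists nt : Z, eq_mod_Z (2 * theta) (IZR nt * alpha) /\ n = Z.abs_nat nt.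

(** ** The smallness threshold for the coupling *)

(* The estimates (a)-(d) of Liu and Yuan for one energy. *)
Definition LY_estimates (C0 Cstar M : R) (lambda : R) (F : C -> C)
    (alpha eta theta : R) (u : Z -> C) (E : R) (m : Z) : Prop :=
  exists n : nat,
    is_resonance_index alpha theta n /\
    (M < IZR (Z.abs m) -> IZR (Z.abs m) <= C0 * INR n) /\
    (forall k : Z, (3 * Z.of_nat n <= Z.abs k)%Z ->
       Cmod (u k) <= Cstar * exp (- (2 * PI * eta * IZR (Z.abs k)))) /\
    (forall k : nat, INR k <= exp (eta * INR n) ->
       Rbar_le (strip_norm eta (transfer lambda F alpha E k))
         (Finite (Cstar * exp (C0 * real (beta alpha) * INR n)))).

(* [theta lambda E] and [u lambda E] are the phase and the dual eigenfunction
   chosen for [E].  [C0] is the absolute constant of the estimates, while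
   [Cstar] and [M] may depend on [lambda] but neither on [E] nor on [m]. *)
Definition is_LY_threshold (C0 : R) (f : R -> R) (F : C -> C) (alpha eta : R)
    (theta : R -> R -> R) (u : R -> R -> Z -> C) (lambda0 : R) : Prop :=
  0 < lambda0 /\
  forall lambda : R, 0 < Rabs lambda <= lambda0 ->
  exists Cstar M : R,
  forall (E : R) (m : Z),
    Sigma lambda f alpha E ->
    eq_mod_Z (2 * rho lambda f alpha E) (IZR m * alpha) ->
    LY_estimates C0 Cstar M lambda F alpha eta (theta lambda E) (u lambda E) E m.

(* Main.v *)
(** Let E be the upper edge of a gap.  By the growth bound the transfer matrices
    at E stay below K = C e^{C beta n} for L ~ e^{eta n} steps.  Pull the
    solutions at energy E - d back by the transfer matrices at E: the pulled back
    vector turns in one direction only, with cross product d a_k^2 at step k, where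
    a_k are the entries of the solution, so two consecutive steps turn it by at
    least d / K^c.  If d L is larger than a power of K, this gives at least half a
    turn in L steps from every initial point, so the rotation number at E - d
    strictly exceeds the one at E and the gap is shorter than d.

    The growth bound applies to the gap edge once E lies in the spectrum, and
    this is Sturm oscillation: the rotation number decreases strictly to the right
    of E, so on a long interval there are three Dirichlet eigenvalues just above E,
    and a combination of the eigenvectors vanishing at both ends is an approximate
    eigenvector.

    The rotation number exists uniformly because the base rotation is isometric:
    two orbits that come close once stay close, so that lifts over different base
    points differ by o(k) after k steps. *)
Require Import Defs.
From Stdlib Require Import Reals ZArith Lra Lia.
From Coquelicot Require Import Coquelicot.

Open Scope R_scope.

(** * Lifts of the Schroedinger steps to the line *)

Definition cross (v v' : R * R) : R := fst v * snd v' - snd v * fst v'.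

Definition step (w : R) (v : R * R) : R * R := (w * fst v - snd v, fst v).

Definition turn_cos (w y : R) : R := 1 - w * sin (2 * PI * y) * cos (2 * PI * y).
Definition turn_sin (w y : R) : R := - (w * cos (2 * PI * y) * cos (2 * PI * y)).
Definition turn_rad (w y : R) : R :=
  sqrt (turn_cos w y * turn_cos w y + turn_sin w y * turn_sin w y).

(* The step matrix is a quarter turn followed by the shear [[1, w], [0, 1]].
   A shear never reverses a vector, so its angle is given by the half-angle
   formula 2 atan (sin / (1 + cos)). *)
Definition turn (w y : R) : R :=
  1 / 4 + atan (turn_sin w y / (turn_cos w y + turn_rad w y)) / PI.

Definition lift_step (w y : R) : R := y + turn w y.

Fixpoint vec_orbit (w : nat -> R) (v : R * R) (k : nat) : R * R :=
  match k with O => v | S j => step (w j) (vec_orbit w v j) end.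

Fixpoint lift_orbit (w : nat -> R) (y : R) (k : nat) : R :=
  match k with O => y | S j => lift_step (w j) (lift_orbit w y j) end.

Lemma sin_cos_sqr (t : R) : sin t * sin t + cos t * cos t = 1.
Proof. exact (sin2_cos2 t). Qed.

Lemma turn_rad_sqr (w y : R) :
  turn_rad w y * turn_rad w y
  = turn_cos w y * turn_cos w y + turn_sin w y * turn_sin w y.
Proof. apply sqrt_sqrt; nra. Qed.

Lemma turn_denom_pos (w y : R) : 0 < turn_cos w y + turn_rad w y.
Proof.
  pose proof (turn_rad_sqr w y) as Hr.
  assert (H0 : 0 <= turn_rad w y) by apply sqrt_pos.
  destruct (Rlt_le_dec 0 (turn_cos w y)) as [H|H]; [lra|].
  assert (Hs : turn_sin w y <> 0).
  { intro Hs. unfold turn_sin, turn_cos in *.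
    assert (Hwc : w * cos (2 * PI * y) = 0).
    { destruct (Req_dec (cos (2 * PI * y)) 0) as [Hc|Hc]; [rewrite Hc; ring|].
      apply Rmult_eq_reg_r with (cos (2 * PI * y)); [lra|exact Hc]. }
    replace (w * sin (2 * PI * y) * cos (2 * PI * y))
      with (w * cos (2 * PI * y) * sin (2 * PI * y)) in H by ring.
    rewrite Hwc in H. lra. }
  assert (0 < turn_sin w y * turn_sin w y) by (apply Rsqr_pos_lt; exact Hs).
  destruct (Rlt_le_dec 0 (turn_cos w y + turn_rad w y)) as [H2|H2]; [exact H2|].
  assert (turn_rad w y * turn_rad w y <= (- turn_cos w y) * (- turn_cos w y))
    by (apply Rmult_le_compat; lra).
  lra.
Qed.

Lemma turn_rad_pos (w y : R) : 0 < turn_rad w y.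
Proof.
  pose proof (turn_denom_pos w y) as Hd. pose proof (turn_rad_sqr w y) as Hr.
  assert (H0 : 0 <= turn_rad w y) by apply sqrt_pos.
  destruct H0 as [H0|H0]; [exact H0|].
  rewrite <- H0 in Hd, Hr. nra.
Qed.

Lemma cos_sin_twice_atan (t : R) :
  cos (2 * atan t) = (1 - t * t) / (1 + t * t) /\ sin (2 * atan t) = 2 * t / (1 + t * t).
Proof.
  assert (Hp : 0 < 1 + t * t) by nra.
  assert (Hs : sqrt (1 + t²) * sqrt (1 + t²) = 1 + t * t)
    by (unfold Rsqr; apply sqrt_sqrt; lra).
  assert (Hs0 : 0 < sqrt (1 + t²)) by (apply sqrt_lt_R0; unfold Rsqr; lra).
  rewrite cos_2a, sin_2a, sin_atan, cos_atan.
  split; rewrite <- Hs; field; lra.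
Qed.

Lemma direction_lift_step (w y : R) :
  step w (direction y)
  = (turn_rad w y * fst (direction (lift_step w y)),
     turn_rad w y * snd (direction (lift_step w y))).
Proof.
  set (T := turn_sin w y / (turn_cos w y + turn_rad w y)).
  pose proof (turn_denom_pos w y) as Hd.
  pose proof (turn_rad_pos w y) as Hr.
  pose proof (turn_rad_sqr w y) as Hq.
  destruct (cos_sin_twice_atan T) as [HC HS].
  assert (H1 : 1 + T * T = 2 * turn_rad w y / (turn_cos w y + turn_rad w y)).
  { unfold T. apply Rmult_eq_reg_r with
      ((turn_cos w y + turn_rad w y) * (turn_cos w y + turn_rad w y)); [|nra].
    field_simplify; [|lra|lra]. nra. }
  assert (HC' : turn_rad w y * cos (2 * atan T) = turn_cos w y).
  { rewrite HC. replace (1 - T * T) with (2 - (1 + T * T)) by ring. rewrite H1.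
    field. split; lra. }
  assert (HS' : turn_rad w y * sin (2 * atan T) = turn_sin w y).
  { rewrite HS, H1. unfold T. field. split; lra. }
  unfold direction, step, lift_step, turn; cbn [fst snd]. fold T.
  replace (2 * PI * (y + (1 / 4 + atan T / PI)))
    with (PI / 2 + (2 * PI * y + 2 * atan T)) by (field; apply PI_neq0).
  pose proof (sin_cos_sqr (2 * PI * y)) as H2.
  replace (cos (PI / 2 + (2 * PI * y + 2 * atan T))) with (- sin (2 * PI * y + 2 * atan T))
    by (rewrite sin_cos; ring).
  rewrite <- cos_sin.
  rewrite sin_plus, cos_plus.
  unfold turn_cos, turn_sin in HC', HS'. 
  set (c := cos (2 * PI * y)) in *; set (s := sin (2 * PI * y)) in *.
  f_equal.
  - replace (turn_rad w y * - (s * cos (2 * atan T) + c * sin (2 * atan T)))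
      with (- (s * (turn_rad w y * cos (2 * atan T)) + c * (turn_rad w y * sin (2 * atan T)))) by ring.
    rewrite HC', HS'.
    replace (- (s * (1 - w * s * c) + c * - (w * c * c))) with (w * c * (s * s + c * c) - s) by ring.
    rewrite H2. ring.
  - replace (turn_rad w y * (c * cos (2 * atan T) - s * sin (2 * atan T)))
      with (c * (turn_rad w y * cos (2 * atan T)) - s * (turn_rad w y * sin (2 * atan T))) by ring.
    rewrite HC', HS'. ring.
Qed.

Lemma continuous_turn (U : UniformSpace) (w y : U -> R) (p : U) :
  continuous w p -> continuous y p -> continuous (fun q => turn (w q) (y q)) p.
Proof.
  intros Hw Hy.
  assert (Ht : continuous (fun q => 2 * PI * y q) p).
  { apply (continuous_mult (K := R_AbsRing) (fun _ => 2 * PI) y); [apply continuous_const|exact Hy]. }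
  assert (Hc : continuous (fun q => cos (2 * PI * y q)) p)
    by (apply (continuous_comp (fun q => 2 * PI * y q) cos); [exact Ht|apply continuous_cos]).
  assert (Hs : continuous (fun q => sin (2 * PI * y q)) p)
    by (apply (continuous_comp (fun q => 2 * PI * y q) sin); [exact Ht|apply continuous_sin]).
  assert (HY : continuous (fun q => turn_sin (w q) (y q)) p).
  { unfold turn_sin. apply (continuous_opp (K := R_AbsRing) (V := R_NormedModule)).
    repeat apply (continuous_mult (K := R_AbsRing)); assumption. }
  assert (HX : continuous (fun q => turn_cos (w q) (y q)) p).
  { unfold turn_cos. apply (continuous_minus (K := R_AbsRing) (V := R_NormedModule));
      [apply continuous_const|].
    repeat apply (continuous_mult (K := R_AbsRing)); assumption. }
  assert (HR : continuous (fun q => turn_rad (w q) (y q)) p).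
  { unfold turn_rad.
    apply (continuous_comp (fun q => turn_cos (w q) (y q) * turn_cos (w q) (y q)
       + turn_sin (w q) (y q) * turn_sin (w q) (y q)) sqrt); [|apply continuous_sqrt].
    apply (continuous_plus (K := R_AbsRing) (V := R_NormedModule));
      apply (continuous_mult (K := R_AbsRing)); assumption. }
  unfold turn. apply (continuous_plus (K := R_AbsRing) (V := R_NormedModule));
    [apply continuous_const|].
  apply (continuous_mult (K := R_AbsRing)); [|apply continuous_const].
  apply (continuous_comp _ atan); [|apply continuous_atan].
  apply (continuous_mult (K := R_AbsRing)); [exact HY|].
  apply (continuous_comp _ Rinv).
  - apply (continuous_plus (K := R_AbsRing) (V := R_NormedModule)); assumption.
  - apply continuous_Rinv. pose proof (turn_denom_pos (w p) (y p)). lra.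
Qed.

Lemma continuous_lift_step (U : UniformSpace) (w y : U -> R) (p : U) :
  continuous w p -> continuous y p -> continuous (fun q => lift_step (w q) (y q)) p.
Proof.
  intros Hw Hy. apply (continuous_plus (K := R_AbsRing) (V := R_NormedModule)); [exact Hy|].
  now apply continuous_turn.
Qed.

Lemma continuous_lift_orbit (U : UniformSpace) (w : U -> nat -> R) (y : U -> R) (k : nat) (p : U) :
  (forall j, continuous (fun q => w q j) p) -> continuous y p ->
  continuous (fun q => lift_orbit (w q) (y q) k) p.
Proof.
  intros Hw Hy. induction k as [|k IH]; simpl; [exact Hy|].
  apply (continuous_lift_step _ (fun q => w q k)); auto.
Qed.

Lemma turn_half (w y : R) : turn w (y + 1 / 2) = turn w y.
Proof.
  unfold turn, turn_rad, turn_cos, turn_sin.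
  replace (2 * PI * (y + 1 / 2)) with (2 * PI * y + PI) by field.
  rewrite neg_sin, neg_cos.
  replace (w * - sin (2 * PI * y) * - cos (2 * PI * y))
    with (w * sin (2 * PI * y) * cos (2 * PI * y)) by ring.
  replace (w * - cos (2 * PI * y) * - cos (2 * PI * y))
    with (w * cos (2 * PI * y) * cos (2 * PI * y)) by ring.
  reflexivity.
Qed.

Lemma periodic_Z (g : R -> R) (T : R) (j : Z) (x : R) :
  (forall t, g (t + T) = g t) -> g (x + IZR j * T) = g x.
Proof.
  intros Hg.
  assert (Hn : forall (n : nat) t, g (t + INR n * T) = g t).
  { induction n as [|n IH]; intro t.
    - simpl. f_equal. ring.
    - rewrite S_INR. replace (t + (INR n + 1) * T) with ((t + INR n * T) + T) by ring.
      rewrite Hg. apply IH. }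
  destruct (Z_le_gt_dec 0 j) as [Hj|Hj].
  - rewrite <- (Z2Nat.id j Hj), <- INR_IZR_INZ. apply Hn.
  - rewrite <- (Hn (Z.to_nat (- j)) (x + IZR j * T)). f_equal.
    rewrite INR_IZR_INZ, Z2Nat.id by lia. rewrite opp_IZR. ring.
Qed.

Lemma turn_half_Z (w y : R) (j : Z) : turn w (y + IZR j / 2) = turn w y.
Proof.
  replace (IZR j / 2) with (IZR j * (1 / 2)) by field.
  apply (periodic_Z (turn w)). apply turn_half.
Qed.

Lemma lift_orbit_half (w : nat -> R) (y : R) (j : Z) (k : nat) :
  lift_orbit w (y + IZR j / 2) k = lift_orbit w y k + IZR j / 2.
Proof.
  induction k as [|k IH]; simpl; [reflexivity|].
  rewrite IH. unfold lift_step. rewrite turn_half_Z. ring.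
Qed.

Lemma turn_bounds (w y : R) : - 1 / 4 < turn w y < 3 / 4.
Proof.
  unfold turn.
  set (T := turn_sin w y / (turn_cos w y + turn_rad w y)).
  pose proof (atan_bound T) as [H1 H2]. pose proof PI_RGT_0 as HP.
  assert (- 1 / 2 < atan T / PI < 1 / 2); [|lra].
  split; apply Rmult_lt_reg_r with PI; try exact HP;
    unfold Rdiv; rewrite (Rmult_assoc (atan T)), Rinv_l by lra; lra.
Qed.

Lemma cross_direction (a b : R) : cross (direction a) (direction b) = sin (2 * PI * (b - a)).
Proof.
  unfold cross, direction; cbn [fst snd].
  replace (2 * PI * (b - a)) with (2 * PI * b - 2 * PI * a) by ring.
  rewrite sin_minus. ring.
Qed.

Lemma cross_step (w : R) (u v : R * R) : cross (step w u) (step w v) = cross u v.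
Proof. unfold cross, step; simpl. ring. Qed.

(* A continuous turn cannot cross an angle of sine -1, hence stays in (0, 1/2). *)
Lemma pos_sin_small (D : R -> R) (a b : R) :
  (forall x, continuous D x) -> a < b -> D a = 0 ->
  (forall x, a < x <= b -> 0 < sin (2 * PI * D x)) -> 0 < D b.
Proof.
  intros HD Hab Ha Hs.
  destruct (Rlt_le_dec 0 (D b)) as [H|H]; [exact H|exfalso].
  assert (Hb : D b < - 1 / 4).
  { destruct (Rlt_le_dec (D b) (- 1 / 4)) as [H'|H']; [exact H'|exfalso].
    specialize (Hs b ltac:(lra)). pose proof PI_RGT_0.
    assert (0 <= sin (2 * PI * - D b)) by (apply sin_ge_0; nra).
    replace (2 * PI * - D b) with (- (2 * PI * D b)) in H1 by ring.
    rewrite sin_neg in H1. lra. }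
  destruct (IVT_gen_consistent D a b (- 1 / 4) HD) as [x [Hx Hv]].
  { rewrite Ha, Rmin_right, Rmax_left; lra. }
  rewrite Rmin_left, Rmax_right in Hx by lra.
  assert (x <> a) by (intro; subst; lra).
  specialize (Hs x ltac:(lra)). rewrite Hv in Hs.
  replace (2 * PI * (- 1 / 4)) with (- (PI / 2)) in Hs by field.
  rewrite sin_neg, sin_PI2 in Hs. lra.
Qed.

Lemma sin_lift_diff (w w' y y' : R) :
  turn_rad w y * turn_rad w' y' * sin (2 * PI * (lift_step w' y' - lift_step w y))
  = cross (step w (direction y)) (step w' (direction y')).
Proof.
  rewrite !direction_lift_step, <- cross_direction.
  unfold cross; simpl. ring.
Qed.

Lemma lift_step_lt (w y y' : R) : y < y' -> lift_step w y < lift_step w y'.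
Proof.
  assert (Hsmall : forall y y', y < y' < y + 1 / 2 -> lift_step w y < lift_step w y').
  { clear. intros y y' Hy.
    assert (0 < lift_step w y' - lift_step w y); [|lra].
    apply (pos_sin_small (fun t => lift_step w t - lift_step w y) y y'); try lra.
    - intro x. apply (continuous_minus (K := R_AbsRing) (V := R_NormedModule));
        [|apply continuous_const].
      apply (continuous_lift_step _ (fun _ => w) (fun t => t));
        [apply continuous_const|apply continuous_id].
    - intros x Hx.
      pose proof (sin_lift_diff w w y x) as E.
      rewrite cross_step, cross_direction in E.
      assert (0 < sin (2 * PI * (x - y))) by (pose proof PI_RGT_0; apply sin_gt_0; nra).
      pose proof (turn_rad_pos w y). pose proof (turn_rad_pos w x).
      apply Rmult_lt_reg_l with (turn_rad w y * turn_rad w x); [nra|].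
      rewrite E. lra. }
  intros Hy.
  destruct (archimed (2 * (y' - y))) as [Hz1 Hz2].
  set (z := (up (2 * (y' - y)) - 1)%Z).
  assert (Hz : IZR z = IZR (up (2 * (y' - y))) - 1) by (unfold z; rewrite minus_IZR; reflexivity).
  assert (Hz0 : 0 <= IZR z).
  { apply (IZR_le 0). assert (0 < up (2 * (y' - y)))%Z by (apply lt_IZR; lra). unfold z; lia. }
  pose proof (turn_half_Z w y' (- z)) as Ht.
  rewrite opp_IZR in Ht.
  assert (Hle : lift_step w y <= lift_step w (y' + - IZR z / 2)).
  { destruct (Req_dec y (y' + - IZR z / 2)) as [<-|Hne]; [lra|].
    left. apply Hsmall. lra. }
  unfold lift_step in *. rewrite Ht in Hle.
  destruct Hz0 as [Hz0|Hz0]; [lra|].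
  assert (y < y' < y + 1/2) by lra. specialize (Hsmall y y' H). lra.
Qed.

Lemma lift_step_anti (w w' y : R) : w' <= w -> lift_step w y <= lift_step w' y.
Proof.
  intros [Hw| ->]; [|lra].
  destruct (Req_dec (cos (2 * PI * y)) 0) as [Hc|Hc].
  { unfold lift_step, turn, turn_rad, turn_cos, turn_sin. rewrite Hc, !Rmult_0_r. lra. }
  assert (0 < lift_step w' y - lift_step w y); [|lra].
  replace (lift_step w' y) with (lift_step (w - (w - w')) y) by (f_equal; ring).
  apply (pos_sin_small (fun t => lift_step (w - t) y - lift_step w y) 0 (w - w')); try lra.
  - intro x. apply (continuous_minus (K := R_AbsRing) (V := R_NormedModule));
      [|apply continuous_const].
    apply (continuous_lift_step _ (fun t => w - t) (fun _ => y)); [|apply continuous_const].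
    apply (continuous_minus (K := R_AbsRing) (V := R_NormedModule));
      [apply continuous_const|apply continuous_id].
  - rewrite Rminus_0_r. ring.
  - intros x Hx. pose proof (sin_lift_diff w (w - x) y y) as E.
    pose proof (turn_rad_pos w y). pose proof (turn_rad_pos (w - x) y).
    apply Rmult_lt_reg_l with (turn_rad w y * turn_rad (w - x) y); [nra|].
    rewrite E. unfold cross, step, direction; simpl.
    assert (0 < cos (2 * PI * y) * cos (2 * PI * y)) by (apply Rsqr_pos_lt; exact Hc).
    nra.
Qed.

Lemma lift_orbit_lt (w : nat -> R) (y y' : R) (k : nat) :
  y < y' -> lift_orbit w y k < lift_orbit w y' k.
Proof. intros H; induction k; simpl; [exact H|now apply lift_step_lt]. Qed.

Lemma lift_orbit_le (w w' : nat -> R) (y y' : R) (k : nat) :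
  (forall j, w' j <= w j) -> y <= y' -> lift_orbit w y k <= lift_orbit w' y' k.
Proof.
  intros Hw H; induction k as [|k IH]; simpl; [exact H|].
  apply Rle_trans with (lift_step (w k) (lift_orbit w' y' k)).
  - destruct IH as [IH| ->]; [left; now apply lift_step_lt|lra].
  - now apply lift_step_anti.
Qed.

Lemma lift_orbit_ext (w w' : nat -> R) (y : R) (k : nat) :
  (forall j, w j = w' j) -> lift_orbit w y k = lift_orbit w' y k.
Proof. intros H; induction k as [|k IH]; simpl; [reflexivity|now rewrite H, IH]. Qed.

Lemma lift_orbit_add (w : nat -> R) (y : R) (m n : nat) :
  lift_orbit w y (m + n) = lift_orbit (fun j => w (m + j)%nat) (lift_orbit w y m) n.
Proof.
  induction n as [|n IH]; simpl.
  - now rewrite Nat.add_0_r.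
  - rewrite Nat.add_succ_r. simpl. now rewrite IH.
Qed.

Lemma lift_orbit_bound (w : nat -> R) (y : R) (k : nat) :
  Rabs (lift_orbit w y k - y) <= INR k.
Proof.
  induction k as [|k IH]; [simpl; rewrite Rminus_diag, Rabs_R0; lra|].
  rewrite S_INR; simpl. unfold lift_step.
  pose proof (turn_bounds (w k) (lift_orbit w y k)).
  apply Rabs_le_between in IH. apply Rabs_le_between. lra.
Qed.

Lemma half_translate (y y' : R) : exists j : Z, y <= y' + IZR j / 2 <= y + 1 / 2.
Proof.
  destruct (archimed (2 * (y - y'))) as [H1 H2].
  exists (up (2 * (y - y'))). lra.
Qed.

Lemma lift_orbit_dev (w : nat -> R) (y y' : R) (k : nat) :
  Rabs ((lift_orbit w y k - y) - (lift_orbit w y' k - y')) <= 1 / 2.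
Proof.
  destruct (half_translate y y') as [j Hj].
  assert (H1 : lift_orbit w y k <= lift_orbit w (y' + IZR j / 2) k)
    by (apply lift_orbit_le; [intro; lra|lra]).
  assert (H2 : lift_orbit w (y' + IZR j / 2) k <= lift_orbit w (y + IZR 1 / 2) k)
    by (apply lift_orbit_le; [intro; lra|simpl; lra]).
  rewrite !lift_orbit_half in *. apply Rabs_le_between. simpl in H2. lra.
Qed.

Lemma vec_orbit_lift (w : nat -> R) (y : R) (k : nat) :
  exists r : R, 0 < r /\
    vec_orbit w (direction y) k
    = (r * fst (direction (lift_orbit w y k)), r * snd (direction (lift_orbit w y k))).
Proof.
  induction k as [|k [r [Hr IH]]].
  - exists 1. split; [lra|]. cbn [vec_orbit lift_orbit]. rewrite !Rmult_1_l. apply surjective_pairing.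
  - exists (r * turn_rad (w k) (lift_orbit w y k)).
    split; [apply Rmult_lt_0_compat; [exact Hr|apply turn_rad_pos]|].
    cbn [vec_orbit lift_orbit]. rewrite IH.
    pose proof (direction_lift_step (w k) (lift_orbit w y k)) as E.
    unfold step in *; cbn [fst snd] in *.
    pose proof (f_equal fst E) as E1; pose proof (f_equal snd E) as E2; cbn [fst snd] in E1, E2.
    apply injective_projections; cbn [fst snd].
    + rewrite Rmult_assoc, <- E1. ring.
    + rewrite Rmult_assoc, <- E2. ring.
Qed.

Lemma lift_orbit_surj (w : nat -> R) (k : nat) (t : R) : exists z, lift_orbit w z k = t.
Proof.
  pose proof (lift_orbit_bound w (t - INR k) k) as H1.
  pose proof (lift_orbit_bound w (t + INR k) k) as H2.
  apply Rabs_le_between in H1. apply Rabs_le_between in H2.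
  destruct (IVT_gen_consistent (fun y => lift_orbit w y k) (t - INR k) (t + INR k) t)
    as [z [_ Hz]].
  - intro x. apply (continuous_lift_orbit _ (fun _ => w) (fun y => y));
      [intro; apply continuous_const|apply continuous_id].
  - split.
    + apply Rle_trans with (lift_orbit w (t - INR k) k); [apply Rmin_l|lra].
    + apply Rle_trans with (lift_orbit w (t + INR k) k); [lra|apply Rmax_r].
  - now exists z.
Qed.

Lemma direction_inj (a b : R) : direction a = direction b -> exists j : Z, a = b + IZR j.
Proof.
  intros H. unfold direction in H. injection H as Hc Hs.
  assert (H1 : cos (2 * (PI * (a - b))) = 1).
  { replace (2 * (PI * (a - b))) with (2 * PI * a - 2 * PI * b) by ring.
    rewrite cos_minus, Hc, Hs. pose proof (sin_cos_sqr (2 * PI * b)). lra. }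
  rewrite cos_2a_sin in H1.
  assert (H2 : sin (PI * (a - b)) = 0) by nra.
  destruct (sin_eq_0_0 _ H2) as [j Hj]. exists j.
  pose proof PI_RGT_0. assert (a - b = IZR j); [|lra].
  apply Rmult_eq_reg_l with PI; lra.
Qed.

(** * Uniform averages over an irrational rotation *)

Lemma irrational_mul (alpha : R) (q p : Z) :
  irrational alpha -> q <> 0%Z -> IZR q * alpha <> IZR p.
Proof.
  intros Ha Hq E. apply (Ha p q Hq). rewrite <- E. field. now apply not_0_IZR.
Qed.

Lemma small_combination (alpha : R) (n : nat) :
  irrational alpha ->
  exists q p : Z, q <> 0%Z /\ 0 < IZR q * alpha - IZR p <= / 2 ^ n.
Proof.
  intros Ha. induction n as [|n [q [p [Hq [Hg1 Hg2]]]]].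
  - exists 1%Z, (up alpha - 1)%Z. split; [lia|].
    destruct (archimed alpha) as [H1 H2]. rewrite minus_IZR. simpl.
    pose proof (irrational_mul alpha 1 (up alpha - 1) Ha ltac:(lia)) as H.
    rewrite minus_IZR in H. lra.
  - set (g := IZR q * alpha - IZR p) in *.
    destruct (archimed (1 / g)) as [H1 H2].
    set (k := (up (1 / g) - 1)%Z).
    assert (Hk : IZR k = IZR (up (1 / g)) - 1) by (unfold k; rewrite minus_IZR; reflexivity).
    assert (Hp2 : / 2 ^ n <= 1).
    { rewrite <- Rinv_1. apply Rinv_le_contravar; [lra|]. apply pow_R1_Rle. lra. }
    assert (Hge : 1 <= 1 / g).
    { apply Rmult_le_reg_r with g; [exact Hg1|]. unfold Rdiv.
      rewrite Rmult_assoc, Rinv_l by lra. lra. }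
    assert (Hk1 : (1 <= k)%Z).
    { assert (1 < up (1 / g))%Z by (apply lt_IZR; simpl; lra). unfold k; lia. }
    assert (Hgg : 1 / g * g = 1) by (field; lra).
    assert (Hr1 : 0 <= 1 - IZR k * g) by nra.
    assert (Hr2 : 1 - IZR k * g < g) by nra.
    assert (Hr0 : 1 - IZR k * g <> 0).
    { intro E. apply (irrational_mul alpha (k * q) (1 + k * p) Ha); [lia|].
      rewrite plus_IZR, !mult_IZR. unfold g in E. lra. }
    assert (Hhalf : / 2 ^ S n = / 2 ^ n / 2) by (simpl; field; apply pow_nonzero; lra).
    destruct (Rle_lt_dec (1 - IZR k * g) (g / 2)) as [H|H].
    + exists (- k * q)%Z, (- 1 - k * p)%Z. split; [lia|].
      replace (IZR (- k * q) * alpha - IZR (- 1 - k * p)) with (1 - IZR k * g)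
        by (unfold g; rewrite minus_IZR, !mult_IZR, opp_IZR; ring).
      lra.
    + exists ((k + 1) * q)%Z, (1 + (k + 1) * p)%Z. split; [lia|].
      replace (IZR ((k + 1) * q) * alpha - IZR (1 + (k + 1) * p)) with (g - (1 - IZR k * g))
        by (unfold g; rewrite plus_IZR, !mult_IZR, plus_IZR; ring).
      lra.
Qed.

Lemma kronecker (alpha delta : R) :
  irrational alpha -> 0 < delta ->
  exists S : Z, forall t : R, exists s k : Z,
    (Z.abs s <= S)%Z /\ Rabs (IZR s * alpha - t - IZR k) < delta.
Proof.
  intros Ha Hd.
  destruct (pow_lt_1_zero (/ 2) ltac:(rewrite Rabs_pos_eq; lra) delta Hd) as [n Hn].
  specialize (Hn n (Nat.le_refl n)).
  rewrite pow_inv in Hn.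
  destruct (small_combination alpha n Ha) as [q [p [Hq [Hg1 Hg2]]]].
  set (g := IZR q * alpha - IZR p) in *.
  rewrite Rabs_pos_eq in Hn by lra.
  exists (up (1 / g) * Z.abs q)%Z. intros t.
  set (t0 := t - IZR (up t - 1)).
  assert (Ht0 : 0 <= t0 < 1).
  { unfold t0. rewrite minus_IZR. destruct (archimed t). lra. }
  destruct (archimed (t0 / g)) as [H1 H2].
  set (k := (up (t0 / g) - 1)%Z).
  assert (Hk : IZR k = IZR (up (t0 / g)) - 1) by (unfold k; rewrite minus_IZR; reflexivity).
  assert (Hgg : t0 / g * g = t0) by (field; lra).
  assert (Hpos : 0 <= t0 / g) by (apply Rdiv_le_0_compat; lra).
  exists (k * q)%Z, (k * p - (up t - 1))%Z. split.
  - rewrite Z.abs_mul. apply Z.mul_le_mono_nonneg_r; [lia|].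
    assert (0 < up (t0 / g))%Z by (apply lt_IZR; lra).
    rewrite Z.abs_eq by (unfold k; lia).
    apply Z.lt_le_incl, lt_IZR.
    assert (t0 / g <= 1 / g)
      by (apply Rmult_le_compat_r; [left; now apply Rinv_0_lt_compat|lra]).
    destruct (archimed (1 / g)). lra.
  - replace (IZR (k * q) * alpha - t - IZR (k * p - (up t - 1))) with (IZR k * g - t0)
      by (unfold g, t0; rewrite !minus_IZR, !mult_IZR; ring).
    apply Rabs_lt_between. nra.
Qed.

(* Two orbits of the rotation which are close once stay close forever; so
   comparing [a M x] with [a M x'] through an orbit point of [x] near [x'] costs
   only a bounded amount plus a small proportion of [M]. *)
Lemma almost_additive_osc (alpha : R) (a : nat -> R -> R) (N : nat) :
  irrational alpha -> (0 < N)%nat ->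
  (forall m n x, Rabs (a (m + n)%nat x - a m x - a n (x + INR m * alpha)) <= 1) ->
  (forall n x, Rabs (a n x) <= INR n) ->
  (forall n x, a n (x + 1) = a n x) ->
  (forall n, exists delta, 0 < delta /\
     forall x x', Rabs (x - x') < delta -> Rabs (a n x - a n x') <= 1) ->
  exists C, forall M x x', Rabs (a M x - a M x') <= 3 / INR N * INR M + C.
Proof.
  intros Hal HN Hadd Hbd Hper Hcont.
  destruct (Hcont N) as [delta [Hd Hcl]].
  assert (H1 : forall q x x', Rabs (x - x') < delta ->
            Rabs (a (q * N)%nat x - a (q * N)%nat x') <= 3 * INR q).
  { induction q as [|q IH]; intros x x' Hx.
    - pose proof (Hbd O x) as B1. pose proof (Hbd O x') as B2. simpl in *.
      apply Rabs_le_between in B1. apply Rabs_le_between in B2.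
      apply Rabs_le_between. lra.
    - rewrite S_INR. simpl.
      pose proof (Hadd N (q * N)%nat x) as A1. pose proof (Hadd N (q * N)%nat x') as A2.
      pose proof (Hcl x x' Hx) as A3.
      specialize (IH (x + INR N * alpha) (x' + INR N * alpha)).
      replace (x + INR N * alpha - (x' + INR N * alpha)) with (x - x') in IH by ring.
      specialize (IH Hx).
      apply Rabs_le_between in A1. apply Rabs_le_between in A2.
      apply Rabs_le_between in A3. apply Rabs_le_between in IH.
      apply Rabs_le_between. lra. }
  assert (HN0 : 0 < INR N) by (now apply lt_0_INR).
  assert (H2 : forall M x x', Rabs (x - x') < delta ->
            Rabs (a M x - a M x') <= 3 / INR N * INR M + 2 * INR N + 2).
  { intros M x x' Hx.
    pose proof (Nat.div_mod_eq M N) as HM.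
    pose proof (Nat.mod_upper_bound M N ltac:(lia)) as Hr.
    set (q := (M / N)%nat) in *. set (r := (M mod N)%nat) in *.
    rewrite Nat.mul_comm in HM.
    assert (HMR : INR M = INR q * INR N + INR r) by (rewrite HM, plus_INR, mult_INR; ring).
    apply lt_INR in Hr. pose proof (pos_INR r) as Hr0.
    assert (3 * INR q <= 3 / INR N * INR M).
    { rewrite HMR. replace (3 / INR N * (INR q * INR N + INR r))
        with (3 * INR q + 3 / INR N * INR r) by (field; lra).
      assert (0 <= 3 / INR N * INR r); [|lra].
      apply Rmult_le_pos; [apply Rdiv_le_0_compat; lra|exact Hr0]. }
    pose proof (H1 q x x' Hx) as A1.
    pose proof (Hadd (q * N)%nat r x) as A2. pose proof (Hadd (q * N)%nat r x') as A3.
    rewrite <- HM in A2, A3.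
    pose proof (Hbd r (x + INR (q * N) * alpha)) as A4.
    pose proof (Hbd r (x' + INR (q * N) * alpha)) as A5.
    apply Rabs_le_between in A1. apply Rabs_le_between in A2. apply Rabs_le_between in A3.
    apply Rabs_le_between in A4. apply Rabs_le_between in A5.
    apply Rabs_le_between. lra. }
  destruct (kronecker alpha delta Hal Hd) as [S HS].
  assert (H3 : forall M n x, Rabs (a M x - a M (x + INR n * alpha)) <= 2 * INR n + 2).
  { intros M n x.
    pose proof (Hadd n M x) as A1. pose proof (Hadd M n x) as A2. rewrite Nat.add_comm in A2.
    pose proof (Hbd n x) as A3. pose proof (Hbd n (x + INR M * alpha)) as A4.
    apply Rabs_le_between in A1. apply Rabs_le_between in A2.
    apply Rabs_le_between in A3. apply Rabs_le_between in A4.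
    apply Rabs_le_between. lra. }
  assert (HperZ : forall M x (k : Z), a M (x + IZR k) = a M x).
  { intros M x k. rewrite <- (Rmult_1_r (IZR k)). now apply (periodic_Z (a M)). }
  exists (2 * INR N + 2 + (2 * IZR S + 2)). intros M x x'.
  destruct (HS (x' - x)) as [s [k [Hs Hk]]].
  assert (Hn : forall n : nat, (Z.of_nat n <= S)%Z -> INR n <= IZR S)
    by (intros n Hn; rewrite INR_IZR_INZ; now apply IZR_le).
  destruct (Z_le_gt_dec 0 s) as [Hs0|Hs0].
  - set (n := Z.to_nat s).
    assert (E : INR n = IZR s) by (unfold n; rewrite INR_IZR_INZ, Z2Nat.id; auto).
    specialize (Hn n ltac:(unfold n; lia)).
    pose proof (H3 M n x) as A1.
    pose proof (H2 M (x + INR n * alpha) (x' + IZR k)) as A2.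
    rewrite HperZ in A2.
    assert (Hx : Rabs (x + INR n * alpha - (x' + IZR k)) < delta).
    { rewrite E. replace (x + IZR s * alpha - (x' + IZR k))
        with (IZR s * alpha - (x' - x) - IZR k) by ring. exact Hk. }
    specialize (A2 Hx).
    apply Rabs_le_between in A1. apply Rabs_le_between in A2.
    apply Rabs_le_between. lra.
  - set (n := Z.to_nat (- s)).
    assert (E : INR n = - IZR s)
      by (unfold n; rewrite INR_IZR_INZ, Z2Nat.id by lia; apply opp_IZR).
    specialize (Hn n ltac:(unfold n; lia)).
    pose proof (H3 M n x') as A1.
    pose proof (H2 M (x' + INR n * alpha + IZR k) x) as A2.
    rewrite HperZ in A2.
    assert (Hx : Rabs (x' + INR n * alpha + IZR k - x) < delta).
    { rewrite E, Rabs_minus_sym. replace (x - (x' + - IZR s * alpha + IZR k))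
        with (IZR s * alpha - (x' - x) - IZR k) by ring. exact Hk. }
    specialize (A2 Hx).
    apply Rabs_le_between in A1. apply Rabs_le_between in A2.
    apply Rabs_le_between. lra.
Qed.

Lemma ex_INR_ge (t : R) : exists n : nat, (0 < n)%nat /\ t <= INR n.
Proof.
  destruct (INR_unbounded t) as [n Hn]. exists (S n). split; [lia|]. rewrite S_INR. lra.
Qed.

Lemma almost_additive_block (alpha omega : R) (a : nat -> R -> R) (q : nat) :
  (0 < q)%nat ->
  (forall m n x, Rabs (a (m + n)%nat x - a m x - a n (x + INR m * alpha)) <= 1) ->
  (forall n x, Rabs (a n x) <= INR n) ->
  (forall x x', Rabs (a q x - a q x') <= omega) ->
  forall M x, Rabs (a M x - INR M * (a q 0 / INR q))
              <= (omega + 1) / INR q * INR M + (2 * INR q + 1).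
Proof.
  intros Hq Hadd Hbd Hosc M x.
  assert (Hq0 : 0 < INR q) by now apply lt_0_INR.
  assert (Hom : 0 <= omega).
  { apply Rle_trans with (Rabs (a q 0 - a q 0)); [apply Rabs_pos|apply Hosc]. }
  assert (Hj : forall j x, Rabs (a (j * q)%nat x - INR j * a q 0) <= INR j * (omega + 1)).
  { clear x. induction j as [|j IH]; intro x.
    - pose proof (Hbd O x) as B. simpl in *. apply Rabs_le_between in B.
      apply Rabs_le_between. lra.
    - rewrite S_INR. simpl.
      pose proof (Hadd q (j * q)%nat x) as A1. specialize (IH (x + INR q * alpha)).
      pose proof (Hosc x 0) as A2.
      apply Rabs_le_between in A1. apply Rabs_le_between in A2. apply Rabs_le_between in IH.
      apply Rabs_le_between. lra. }
  pose proof (Nat.div_mod_eq M q) as HM.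
  pose proof (Nat.mod_upper_bound M q ltac:(lia)) as Hr.
  set (j := (M / q)%nat) in *. set (r := (M mod q)%nat) in *.
  rewrite Nat.mul_comm in HM.
  assert (HMR : INR M = INR j * INR q + INR r) by (rewrite HM, plus_INR, mult_INR; ring).
  apply lt_INR in Hr. pose proof (pos_INR r) as Hr0.
  pose proof (Hadd (j * q)%nat r x) as A1. rewrite <- HM in A1.
  pose proof (Hbd r (x + INR (j * q) * alpha)) as A2.
  pose proof (Hj j x) as A3.
  pose proof (Hbd q 0) as A4.
  assert (E1 : INR M * (a q 0 / INR q) = INR j * a q 0 + INR r * (a q 0 / INR q))
    by (rewrite HMR; field; lra).
  assert (E2 : (omega + 1) / INR q * INR M = INR j * (omega + 1) + INR r * ((omega + 1) / INR q))
    by (rewrite HMR; field; lra).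
  assert (E3 : 0 <= INR r * ((omega + 1) / INR q)).
  { apply Rmult_le_pos; [exact Hr0|]. apply Rdiv_le_0_compat; lra. }
  assert (E4 : Rabs (INR r * (a q 0 / INR q)) <= INR q).
  { rewrite Rabs_mult, (Rabs_pos_eq _ Hr0).
    assert (Rabs (a q 0 / INR q) <= 1).
    { unfold Rdiv. rewrite Rabs_mult, Rabs_inv, (Rabs_pos_eq (INR q)) by lra.
      apply Rmult_le_reg_r with (INR q); [exact Hq0|].
      rewrite Rmult_assoc, Rinv_l by lra. lra. }
    pose proof (Rabs_pos (a q 0 / INR q)). nra. }
  apply Rabs_le_between in A1. apply Rabs_le_between in A2. apply Rabs_le_between in A3.
  apply Rabs_le_between in E4.
  apply Rabs_le_between. lra.
Qed.

Lemma uniform_average (alpha : R) (a : nat -> R -> R) :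
  irrational alpha ->
  (forall m n x, Rabs (a (m + n)%nat x - a m x - a n (x + INR m * alpha)) <= 1) ->
  (forall n x, Rabs (a n x) <= INR n) ->
  (forall n x, a n (x + 1) = a n x) ->
  (forall n, exists delta, 0 < delta /\
     forall x x', Rabs (x - x') < delta -> Rabs (a n x - a n x') <= 1) ->
  exists r : R, forall eps, 0 < eps -> exists M0 : nat, forall M x, (M0 <= M)%nat ->
    Rabs (a M x - INR M * r) <= eps * INR M.
Proof.
  intros Hal Hadd Hbd Hper Hcont.
  assert (H1 : forall eps, 0 < eps -> exists (c : R) (M0 : nat), forall M x, (M0 <= M)%nat ->
            Rabs (a M x - INR M * c) <= eps * INR M).
  { intros eps He.
    destruct (ex_INR_ge (9 / eps)) as [N [HN HN']].
    assert (HN0 : 0 < INR N) by now apply lt_0_INR.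
    assert (HN3 : 3 / INR N <= eps / 3).
    { apply Rmult_le_reg_r with (INR N); [exact HN0|].
      replace (3 / INR N * INR N) with 3 by (field; lra).
      apply (Rmult_le_compat_l (eps / 3)) in HN'; [|lra].
      replace (eps / 3 * (9 / eps)) with 3 in HN' by (field; lra). exact HN'. }
    destruct (almost_additive_osc alpha a N Hal HN Hadd Hbd Hper Hcont) as [C HC].
    destruct (ex_INR_ge (3 * (C + 1) / eps)) as [q [Hq Hq']].
    assert (Hq0 : 0 < INR q) by now apply lt_0_INR.
    pose proof (almost_additive_block alpha _ a q Hq Hadd Hbd (fun x x' => HC q x x')) as HB.
    destruct (ex_INR_ge (3 * (2 * INR q + 1) / eps)) as [M0 [_ HM0]].
    exists (a q 0 / INR q), M0. intros M x HM.
    eapply Rle_trans; [apply HB|].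
    apply le_INR in HM. pose proof (pos_INR M) as HMp.
    assert (E1 : 2 * INR q + 1 <= eps / 3 * INR M).
    { apply (Rmult_le_compat_l (eps / 3)) in HM0; [|lra].
      replace (eps / 3 * (3 * (2 * INR q + 1) / eps)) with (2 * INR q + 1) in HM0 by (field; lra).
      apply (Rmult_le_compat_l (eps / 3)) in HM; [lra|lra]. }
    assert (E2 : C + 1 <= eps / 3 * INR q).
    { apply (Rmult_le_compat_l (eps / 3)) in Hq'; [|lra].
      replace (eps / 3 * (3 * (C + 1) / eps)) with (C + 1) in Hq' by (field; lra). exact Hq'. }
    assert (E3 : (3 / INR N * INR q + C + 1) / INR q <= 2 * eps / 3).
    { apply Rmult_le_reg_r with (INR q); [exact Hq0|].
      replace ((3 / INR N * INR q + C + 1) / INR q * INR q)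
        with (3 / INR N * INR q + C + 1) by (field; lra). nra. }
    apply Rmult_le_compat_r with (r := INR M) in E3; [|exact HMp]. lra. }
  assert (H2 : ex_finite_lim_seq (fun M => a M 0 / INR M)).
  { apply ex_lim_seq_cauchy_corr. intros eps.
    destruct (H1 (eps / 3) ltac:(destruct eps; simpl; lra)) as [c [M0 HM]].
    exists (S M0).
    assert (HB : forall M, (S M0 <= M)%nat -> Rabs (a M 0 / INR M - c) <= eps / 3).
    { intros M HMM. specialize (HM M 0 ltac:(lia)).
      assert (0 < INR M) by (apply lt_0_INR; lia).
      replace (a M 0 / INR M - c) with ((a M 0 - INR M * c) / INR M) by (field; lra).
      unfold Rdiv at 1. rewrite Rabs_mult, Rabs_inv, (Rabs_pos_eq (INR M)) by lra.
      apply Rmult_le_reg_r with (INR M); [assumption|].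
      rewrite Rmult_assoc, Rinv_l by lra. lra. }
    intros n m Hn Hm. pose proof (HB n Hn) as A1. pose proof (HB m Hm) as A2.
    apply Rabs_le_between in A1. apply Rabs_le_between in A2.
    apply Rabs_lt_between. destruct eps as [e He]; simpl in *. lra. }
  destruct H2 as [r Hr]. exists r. intros eps He.
  destruct (H1 (eps / 2) ltac:(lra)) as [c [M0 HM]].
  assert (Hcr : Rabs (r - c) <= eps / 2).
  { assert (HL : is_lim_seq (fun M => Rabs (a M 0 / INR M - c)) (Rabs (r - c))).
    { apply (is_lim_seq_abs _ (Finite (r - c))).
      apply (is_lim_seq_minus' _ _ r c Hr). apply is_lim_seq_const. }
    apply (is_lim_seq_le_loc _ (fun _ => eps / 2) (Rabs (r - c)) (eps / 2)) in HL;
      [exact HL| |apply is_lim_seq_const].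
    exists (S M0). intros M HMM. specialize (HM M 0 ltac:(lia)).
    assert (0 < INR M) by (apply lt_0_INR; lia).
    replace (a M 0 / INR M - c) with ((a M 0 - INR M * c) / INR M) by (field; lra).
    unfold Rdiv at 1. rewrite Rabs_mult, Rabs_inv, (Rabs_pos_eq (INR M)) by lra.
    apply Rmult_le_reg_r with (INR M); [assumption|].
    rewrite Rmult_assoc, Rinv_l by lra. lra. }
  exists M0. intros M x HMM. specialize (HM M x HMM).
  pose proof (pos_INR M).
  replace (a M x - INR M * r) with ((a M x - INR M * c) + - (INR M * (r - c))) by ring.
  eapply Rle_trans; [apply Rabs_triang|].
  rewrite Rabs_Ropp, Rabs_mult, (Rabs_pos_eq (INR M)) by assumption. nra.
Qed.

Lemma lift_step_unif (W eps : R) :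
  0 < eps -> exists delta, 0 < delta /\ forall w w' y y',
    Rabs w <= W -> Rabs w' <= W -> Rabs (w - w') < delta -> Rabs (y - y') < delta ->
    Rabs (lift_step w y - lift_step w' y') < eps.
Proof.
  intros He.
  assert (Hc : forall x y, - W <= x <= W -> - 1 <= y <= 2 -> continuity_2d_pt turn x y).
  { intros x y _ _. apply continuity_2d_pt_filterlim.
    apply (continuous_turn _ (fun z : R * R => fst z) (fun z : R * R => snd z) (x, y));
      [apply continuous_fst|apply continuous_snd]. }
  destruct (uniform_continuity_2d turn (- W) W (- 1) 2 Hc (mkposreal (eps / 2) ltac:(lra)))
    as [[d Hd] HU]. simpl in HU.
  exists (Rmin d (Rmin 1 (eps / 2))).
  split; [repeat apply Rmin_pos; lra|].
  intros w w' y y' Hw Hw' Hww Hyy.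
  pose proof (Rmin_l d (Rmin 1 (eps / 2))). pose proof (Rmin_r d (Rmin 1 (eps / 2))).
  pose proof (Rmin_l 1 (eps / 2)). pose proof (Rmin_r 1 (eps / 2)).
  set (j := (up y - 1)%Z).
  assert (Hj : 0 <= y - IZR j < 1).
  { unfold j. rewrite minus_IZR. destruct (archimed y). lra. }
  assert (Ht : forall w t, turn w (t - IZR j) = turn w t).
  { intros v t. rewrite <- (turn_half_Z v t (- (2 * j))). f_equal.
    rewrite opp_IZR, mult_IZR. field. }
  apply Rabs_le_between in Hw. apply Rabs_le_between in Hw'.
  assert (Hyy' := Hyy). apply Rabs_lt_between in Hyy'.
  assert (HU' : Rabs (turn w (y - IZR j) - turn w' (y' - IZR j)) < eps / 2).
  { apply HU; try lra.
    replace (y - IZR j - (y' - IZR j)) with (y - y') by ring. lra. }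
  rewrite !Ht in HU'. unfold lift_step.
  apply Rabs_lt_between in HU'. apply Rabs_lt_between. lra.
Qed.

Lemma lift_orbit_unif (W : R) (N : nat) : forall eps : R,
  0 < eps -> exists delta, 0 < delta /\ forall w w' y y',
    (forall j, Rabs (w j) <= W) -> (forall j, Rabs (w' j) <= W) ->
    (forall j, Rabs (w j - w' j) < delta) -> Rabs (y - y') < delta ->
    Rabs (lift_orbit w y N - lift_orbit w' y' N) < eps.
Proof.
  induction N as [|N IH]; intros eps He.
  - exists eps. simpl. auto.
  - destruct (lift_step_unif W eps He) as [d1 [Hd1 H1]].
    destruct (IH d1 Hd1) as [d2 [Hd2 H2]].
    exists (Rmin d1 d2). split; [now apply Rmin_pos|].
    intros w w' y y' Hw Hw' Hww Hyy. simpl.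
    pose proof (Rmin_l d1 d2). pose proof (Rmin_r d1 d2).
    apply H1; auto.
    + specialize (Hww N). lra.
    + apply H2; auto; [|lra]. intro j. specialize (Hww j). lra.
Qed.

(** * The rotation number *)

Definition potential (lambda : R) (f : R -> R) (alpha E x : R) (j : nat) : R :=
  E - lambda * f (x + INR j * alpha).

Definition uniform_rotation (lambda : R) (f : R -> R) (alpha E r : R) : Prop :=
  forall eps, 0 < eps -> exists M0 : nat, forall (M : nat) (x y : R), (M0 <= M)%nat ->
    Rabs (lift_orbit (potential lambda f alpha E x) y M - y - INR M * r) <= eps * INR M.

Lemma potential_shift (lambda : R) (f : R -> R) (alpha E x y : R) (m n : nat) :
  lift_orbit (potential lambda f alpha E x) y (m + n)
  = lift_orbit (potential lambda f alpha E (x + INR m * alpha))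
      (lift_orbit (potential lambda f alpha E x) y m) n.
Proof.
  rewrite lift_orbit_add. apply lift_orbit_ext. intro j. unfold potential.
  rewrite plus_INR. do 3 f_equal. ring.
Qed.

Lemma periodic_unif_continuous (f : R -> R) :
  (forall x, continuous f x) -> (forall x, f (x + 1) = f x) ->
  forall eps, 0 < eps -> exists delta, 0 < delta /\
    forall x x', Rabs (x - x') < delta -> Rabs (f x - f x') < eps.
Proof.
  intros Hc Hp eps He.
  assert (Hc' : forall x, - 1 <= x <= 2 -> continuity_pt f x)
    by (intros x _; apply continuity_pt_filterlim; apply Hc).
  destruct (Heine_cor2 Hc' (mkposreal eps He)) as [[d Hd] HU].
  simpl in HU. exists (Rmin d 1). split; [apply Rmin_pos; lra|].
  intros x x' Hx. pose proof (Rmin_l d 1). pose proof (Rmin_r d 1).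
  set (j := (- (up x - 1))%Z).
  assert (Hj : 0 <= x + IZR j < 1).
  { unfold j. rewrite opp_IZR, minus_IZR. destruct (archimed x). lra. }
  rewrite <- (periodic_Z f 1 j x Hp), <- (periodic_Z f 1 j x' Hp), Rmult_1_r.
  assert (Hx' := Hx). apply Rabs_lt_between in Hx'.
  apply HU; try lra.
  replace (x + IZR j - (x' + IZR j)) with (x - x') by ring. lra.
Qed.

Lemma periodic_bounded (f : R -> R) :
  (forall x, continuous f x) -> (forall x, f (x + 1) = f x) ->
  exists B, forall x, Rabs (f x) <= B.
Proof.
  intros Hc Hp.
  destruct (continuity_ab_maj (fun t => Rabs (f t)) 0 1 ltac:(lra)) as [c [Hcm _]].
  { intros t _. apply continuity_pt_filterlim.
    apply (continuous_comp f Rabs); [apply Hc|apply continuous_Rabs]. }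
  exists (Rabs (f c)). intros x.
  set (j := (- (up x - 1))%Z).
  assert (Hj : 0 <= x + IZR j < 1).
  { unfold j. rewrite opp_IZR, minus_IZR. destruct (archimed x). lra. }
  rewrite <- (periodic_Z f 1 j x Hp), Rmult_1_r. apply Hcm. lra.
Qed.

Lemma potential_bounded (lambda : R) (f : R -> R) (alpha B R0 E x : R) (j : nat) :
  (forall x, Rabs (f x) <= B) -> Rabs E <= R0 ->
  Rabs (potential lambda f alpha E x j) <= R0 + Rabs lambda * B.
Proof.
  intros HB HE. unfold potential, Rminus.
  eapply Rle_trans; [apply Rabs_triang|]. rewrite Rabs_Ropp, Rabs_mult.
  apply Rplus_le_compat; [exact HE|].
  apply Rmult_le_compat_l; [apply Rabs_pos|apply HB].
Qed.

Lemma uniform_rotation_exists (lambda : R) (f : R -> R) (alpha E : R) :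
  irrational alpha -> (forall x, continuous f x) -> (forall x, f (x + 1) = f x) ->
  exists r, uniform_rotation lambda f alpha E r.
Proof.
  intros Ha Hc Hp.
  destruct (periodic_bounded f Hc Hp) as [B HB].
  destruct (uniform_average alpha
    (fun M x => lift_orbit (potential lambda f alpha E x) 0 M) Ha) as [r Hr].
  - intros m n x. cbv beta. rewrite potential_shift.
    pose proof (lift_orbit_dev (potential lambda f alpha E (x + INR m * alpha))
      (lift_orbit (potential lambda f alpha E x) 0 m) 0 n) as D.
    apply Rabs_le_between in D. apply Rabs_le_between. lra.
  - intros n x. cbv beta.
    pose proof (lift_orbit_bound (potential lambda f alpha E x) 0 n) as D.
    rewrite Rminus_0_r in D. exact D.
  - intros n x. apply lift_orbit_ext. intro j. unfold potential.
    replace (x + 1 + INR j * alpha) with (x + INR j * alpha + 1) by ring. now rewrite Hp.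
  - intros n. cbv beta.
    destruct (lift_orbit_unif (Rabs E + Rabs lambda * B) n 1 ltac:(lra)) as [d [Hd H1]].
    destruct (periodic_unif_continuous f Hc Hp (d / (Rabs lambda + 1))) as [d' [Hd' H2]].
    { apply Rdiv_lt_0_compat; [exact Hd|]. pose proof (Rabs_pos lambda). lra. }
    exists d'. split; [exact Hd'|]. intros x x' Hx. left. apply H1.
    + intro j. apply potential_bounded; [exact HB|lra].
    + intro j. apply potential_bounded; [exact HB|lra].
    + intro j. unfold potential.
      replace (E - lambda * f (x + INR j * alpha) - (E - lambda * f (x' + INR j * alpha)))
        with (- (lambda * (f (x + INR j * alpha) - f (x' + INR j * alpha)))) by ring.
      rewrite Rabs_Ropp, Rabs_mult.
      specialize (H2 (x + INR j * alpha) (x' + INR j * alpha)).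
      replace (x + INR j * alpha - (x' + INR j * alpha)) with (x - x') in H2 by ring.
      specialize (H2 Hx). pose proof (Rabs_pos lambda).
      apply Rmult_lt_compat_r with (r := Rabs lambda + 1) in H2; [|lra].
      replace (d / (Rabs lambda + 1) * (Rabs lambda + 1)) with d in H2 by (field; lra).
      pose proof (Rabs_pos (f (x + INR j * alpha) - f (x' + INR j * alpha))). nra.
    + rewrite Rminus_diag, Rabs_R0. exact Hd.
  - exists r. intros eps He.
    destruct (Hr (eps / 2) ltac:(lra)) as [M1 H1].
    destruct (ex_INR_ge (1 / eps)) as [M2 [_ H2]].
    exists (max M1 M2). intros M x y HM.
    specialize (H1 M x ltac:(lia)). cbv beta in H1.
    assert (HMM : INR M2 <= INR M) by (apply le_INR; lia).
    assert (H3 : 1 <= eps * INR M).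
    { apply Rmult_le_compat_l with (r := eps) in H2; [|lra].
      replace (eps * (1 / eps)) with 1 in H2 by (field; lra). nra. }
    pose proof (lift_orbit_dev (potential lambda f alpha E x) y 0 M) as D.
    apply Rabs_le_between in D. apply Rabs_le_between in H1. apply Rabs_le_between. lra.
Qed.

Lemma uniform_rotation_le (lambda : R) (f : R -> R) (alpha E r : R) (L : nat) (x y c C : R) :
  uniform_rotation lambda f alpha E r -> (0 < L)%nat ->
  (forall j, lift_orbit (potential lambda f alpha E x) y (j * L) <= C + INR j * c) ->
  INR L * r <= c.
Proof.
  intros Hr HL Hj. apply Rnot_lt_le. intro Hlt.
  assert (HL0 : 0 < INR L) by now apply lt_0_INR.
  set (g := INR L * r - c).
  assert (Hg : 0 < g) by (unfold g; lra).
  destruct (Hr (g / (2 * INR L))) as [M0 HM]; [apply Rdiv_lt_0_compat; lra|].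
  destruct (ex_INR_ge ((C - y + 1) * 2 / g)) as [j1 [_ Hj1]].
  set (j := max M0 j1).
  specialize (HM (j * L)%nat x y ltac:(unfold j; nia)). specialize (Hj j).
  rewrite mult_INR in HM.
  replace (g / (2 * INR L) * (INR j * INR L)) with (INR j * (g / 2)) in HM by (field; lra).
  assert (INR j1 <= INR j) by (apply le_INR; unfold j; lia).
  apply Rmult_le_compat_r with (r := g / 2) in Hj1; [|lra].
  replace ((C - y + 1) * 2 / g * (g / 2)) with (C - y + 1) in Hj1 by (field; lra).
  apply Rabs_le_between in HM.
  assert (INR j * (INR L * r) = INR j * (g + c)) by (unfold g; ring).
  assert (INR j1 * (g / 2) <= INR j * (g / 2)) by (apply Rmult_le_compat_r; lra).
  lra.
Qed.

Lemma uniform_rotation_ge (lambda : R) (f : R -> R) (alpha E r : R) (L : nat) (x y c C : R) :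
  uniform_rotation lambda f alpha E r -> (0 < L)%nat ->
  (forall j, C + INR j * c <= lift_orbit (potential lambda f alpha E x) y (j * L)) ->
  c <= INR L * r.
Proof.
  intros Hr HL Hj. apply Rnot_lt_le. intro Hlt.
  assert (HL0 : 0 < INR L) by now apply lt_0_INR.
  set (g := c - INR L * r).
  assert (Hg : 0 < g) by (unfold g; lra).
  destruct (Hr (g / (2 * INR L))) as [M0 HM]; [apply Rdiv_lt_0_compat; lra|].
  destruct (ex_INR_ge ((y - C + 1) * 2 / g)) as [j1 [_ Hj1]].
  set (j := max M0 j1).
  specialize (HM (j * L)%nat x y ltac:(unfold j; nia)). specialize (Hj j).
  rewrite mult_INR in HM.
  replace (g / (2 * INR L) * (INR j * INR L)) with (INR j * (g / 2)) in HM by (field; lra).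
  assert (INR j1 <= INR j) by (apply le_INR; unfold j; lia).
  apply Rmult_le_compat_r with (r := g / 2) in Hj1; [|lra].
  replace ((y - C + 1) * 2 / g * (g / 2)) with (y - C + 1) in Hj1 by (field; lra).
  apply Rabs_le_between in HM.
  assert (INR j * (INR L * r) = INR j * (c - g)) by (unfold g; ring).
  assert (INR j1 * (g / 2) <= INR j * (g / 2)) by (apply Rmult_le_compat_r; lra).
  lra.
Qed.

Lemma lift_step_vertical (w : R) (j : Z) :
  lift_step w (1 / 4 + IZR j / 2) = 1 / 2 + IZR j / 2.
Proof.
  unfold lift_step. rewrite turn_half_Z. unfold turn, turn_sin.
  replace (2 * PI * (1 / 4)) with (PI / 2) by field.
  rewrite cos_PI2, !Rmult_0_r, Ropp_0. unfold Rdiv. rewrite Rmult_0_l, atan_0.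
  field. apply PI_neq0.
Qed.

Lemma lift_orbit_lower (w : nat -> R) (k : nat) : - 1 / 4 <= lift_orbit w 0 k.
Proof.
  induction k as [|k IH]; simpl; [lra|].
  pose proof (lift_step_vertical (w k) (- 1)) as E.
  replace (1 / 4 + IZR (- 1) / 2) with (- 1 / 4) in E by field.
  assert (lift_step (w k) (- 1 / 4) <= lift_step (w k) (lift_orbit w 0 k)).
  { destruct IH as [IH|IH]; [left; now apply lift_step_lt|rewrite IH; lra]. }
  simpl in E. lra.
Qed.

Lemma lift_orbit_upper (w : nat -> R) (k : nat) : lift_orbit w 0 k <= 1 / 4 + INR k * (1 / 2).
Proof.
  induction k as [|k IH]; [simpl; lra|]. rewrite S_INR; simpl.
  pose proof (lift_step_vertical (w k) (Z.of_nat k)) as E.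
  rewrite <- INR_IZR_INZ in E.
  assert (lift_step (w k) (lift_orbit w 0 k) <= lift_step (w k) (1 / 4 + INR k / 2)).
  { replace (1 / 4 + INR k / 2) with (1 / 4 + INR k * (1 / 2)) by field.
    destruct IH as [IH|IH]; [left; now apply lift_step_lt|rewrite IH; lra]. }
  lra.
Qed.

Lemma atan_m1 : atan (- 1) = - (PI / 4).
Proof. rewrite <- atan_1, <- atan_opp. reflexivity. Qed.

Lemma atan_le (a b : R) : a <= b -> atan a <= atan b.
Proof. intros [H| ->]; [left; now apply atan_increasing|lra]. Qed.

Lemma sqr_eighth : (1 / sqrt 2) * (1 / sqrt 2) = 1 / 2.
Proof.
  assert (Hs : 0 < sqrt 2) by (apply sqrt_lt_R0; lra).
  assert (Hq : sqrt 2 * sqrt 2 = 2) by (apply sqrt_sqrt; lra).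
  replace (1 / sqrt 2 * (1 / sqrt 2)) with (1 / (sqrt 2 * sqrt 2)) by (field; lra).
  rewrite Hq. field.
Qed.

Lemma lift_step_diag (w : R) : 2 <= w -> lift_step w (1 / 8) <= 1 / 8.
Proof.
  intros Hw. unfold lift_step, turn.
  set (T := turn_sin w (1 / 8) / (turn_cos w (1 / 8) + turn_rad w (1 / 8))).
  assert (HT : T <= - 1).
  { pose proof (turn_denom_pos w (1 / 8)) as Hd. pose proof (turn_rad_pos w (1 / 8)) as Hr.
    pose proof (turn_rad_sqr w (1 / 8)) as Hq.
    assert (Es : turn_sin w (1 / 8) = - w / 2).
    { unfold turn_sin. replace (2 * PI * (1 / 8)) with (PI / 4) by field.
      rewrite cos_PI4, Rmult_assoc, sqr_eighth. field. }
    assert (Ec : turn_cos w (1 / 8) = 1 - w / 2).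
    { unfold turn_cos. replace (2 * PI * (1 / 8)) with (PI / 4) by field.
      rewrite cos_PI4, sin_PI4, Rmult_assoc, sqr_eighth. field. }
    apply Rmult_le_reg_r with (turn_cos w (1 / 8) + turn_rad w (1 / 8)); [exact Hd|].
    unfold T, Rdiv. rewrite Rmult_assoc, Rinv_l by lra.
    rewrite Es, Ec in *. assert (turn_rad w (1 / 8) <= w - 1); [|lra].
    apply Rsqr_incr_0_var; [unfold Rsqr; nra|lra]. }
  apply atan_le in HT. rewrite atan_m1 in HT. pose proof PI_RGT_0.
  assert (atan T / PI <= - 1 / 4); [|lra].
  apply Rmult_le_reg_r with PI; [assumption|].
  unfold Rdiv at 1. rewrite Rmult_assoc, Rinv_l by lra. lra.
Qed.

Lemma lift_step_antidiag (w : R) : w <= - 2 -> - 1 / 8 + 1 / 2 <= lift_step w (- 1 / 8).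
Proof.
  intros Hw. unfold lift_step, turn.
  set (T := turn_sin w (- 1 / 8) / (turn_cos w (- 1 / 8) + turn_rad w (- 1 / 8))).
  assert (HT : 1 <= T).
  { pose proof (turn_denom_pos w (- 1 / 8)) as Hd. pose proof (turn_rad_pos w (- 1 / 8)) as Hr.
    pose proof (turn_rad_sqr w (- 1 / 8)) as Hq.
    assert (Es : turn_sin w (- 1 / 8) = - w / 2).
    { unfold turn_sin. replace (2 * PI * (- 1 / 8)) with (- (PI / 4)) by field.
      rewrite cos_neg, cos_PI4, Rmult_assoc, sqr_eighth. field. }
    assert (Ec : turn_cos w (- 1 / 8) = 1 + w / 2).
    { unfold turn_cos. replace (2 * PI * (- 1 / 8)) with (- (PI / 4)) by field.
      rewrite cos_neg, sin_neg, cos_PI4, sin_PI4.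
      replace (w * - (1 / sqrt 2) * (1 / sqrt 2)) with (- w * (1 / sqrt 2 * (1 / sqrt 2))) by ring.
      rewrite sqr_eighth. field. }
    apply Rmult_le_reg_r with (turn_cos w (- 1 / 8) + turn_rad w (- 1 / 8)); [exact Hd|].
    unfold T, Rdiv. rewrite Rmult_assoc, Rinv_l by lra.
    rewrite Es, Ec in *. assert (turn_rad w (- 1 / 8) <= - w - 1); [|lra].
    apply Rsqr_incr_0_var; [unfold Rsqr; nra|lra]. }
  apply atan_le in HT. rewrite atan_1 in HT. pose proof PI_RGT_0.
  assert (1 / 4 <= atan T / PI); [|lra].
  apply Rmult_le_reg_r with PI; [assumption|].
  unfold Rdiv at 2. rewrite Rmult_assoc, Rinv_l by lra. lra.
Qed.

Lemma lift_orbit_diag (w : nat -> R) (k : nat) :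
  (forall j, 2 <= w j) -> lift_orbit w (1 / 8) k <= 1 / 8.
Proof.
  intros Hw. induction k as [|k IH]; simpl; [lra|].
  apply Rle_trans with (lift_step (w k) (1 / 8)); [|now apply lift_step_diag].
  destruct IH as [IH|IH]; [left; now apply lift_step_lt|rewrite IH; lra].
Qed.

Lemma lift_orbit_antidiag (w : nat -> R) (k : nat) :
  (forall j, w j <= - 2) -> - 1 / 8 + INR k * (1 / 2) <= lift_orbit w (- 1 / 8) k.
Proof.
  intros Hw. induction k as [|k IH]; [simpl; lra|]. rewrite S_INR; simpl.
  apply Rle_trans with (lift_step (w k) (- 1 / 8 + IZR (Z.of_nat k) / 2)).
  - pose proof (lift_step_antidiag (w k) (Hw k)) as H. unfold lift_step in *.
    rewrite turn_half_Z, <- INR_IZR_INZ. lra.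
  - rewrite <- INR_IZR_INZ.
    replace (- 1 / 8 + INR k / 2) with (- 1 / 8 + INR k * (1 / 2)) by field.
    destruct IH as [IH|IH]; [left; now apply lift_step_lt|rewrite IH; lra].
Qed.

Lemma angle_orbit_lift (lambda : R) (f : R -> R) (alpha E x y : R) (k : nat) :
  angle_orbit alpha (fun x y => turn (E - lambda * f x) y) x y k
  = lift_orbit (potential lambda f alpha E x) y k.
Proof. induction k as [|k IH]; simpl; [reflexivity|]. now rewrite IH. Qed.

Lemma mat_vec_S_real (lambda : R) (f : R -> R) (E x : R) (v : R * R) :
  mat_vec (K := R_Ring) (S_real lambda f E x) v = step (E - lambda * f x) v.
Proof.
  destruct v as [a b]. unfold mat_vec, S_real, step_matrix, step, coeff_mat; simpl.
  unfold plus, mult, opp, one, zero; simpl. f_equal; ring.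
Qed.

Lemma is_angle_lift_turn (lambda : R) (f : R -> R) (E : R) :
  (forall x, continuous f x) -> (forall x, f (x + 1) = f x) ->
  is_angle_lift (S_real lambda f E) (fun x y => turn (E - lambda * f x) y).
Proof.
  intros Hc Hp. split; [|split; [|split]].
  - intros p.
    apply (continuous_turn _ (fun q : R * R => E - lambda * f (fst q)) (fun q => snd q) p);
      [|destruct p; apply continuous_snd].
    apply (continuous_minus (K := R_AbsRing) (V := R_NormedModule)); [apply continuous_const|].
    apply (continuous_mult (K := R_AbsRing)); [apply continuous_const|].
    apply (continuous_comp fst f); [destruct p; apply continuous_fst|apply Hc].
  - intros x y. now rewrite Hp.
  - intros x y. rewrite <- (turn_half_Z _ y 2). f_equal. simpl. field.
  - intros x y. exists (turn_rad (E - lambda * f x) y). split; [apply turn_rad_pos|].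
    rewrite mat_vec_S_real. apply direction_lift_step.
Qed.

Lemma direction_scale_inj (r s a b : R) :
  0 < r -> 0 < s ->
  (r * fst (direction a), r * snd (direction a)) = (s * fst (direction b), s * snd (direction b)) ->
  direction a = direction b.
Proof.
  intros Hr Hs E. unfold direction in *; cbn [fst snd] in *.
  pose proof (f_equal fst E) as E1; pose proof (f_equal snd E) as E2; cbn [fst snd] in E1, E2.
  pose proof (sin_cos_sqr (2 * PI * a)) as Ha. pose proof (sin_cos_sqr (2 * PI * b)) as Hb.
  assert (r = s).
  { apply Rsqr_inj; try lra. unfold Rsqr.
    replace (r * r) with ((r * sin (2 * PI * a)) * (r * sin (2 * PI * a))
       + (r * cos (2 * PI * a)) * (r * cos (2 * PI * a)))
      by (transitivity (r * r * (sin (2 * PI * a) * sin (2 * PI * a)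
             + cos (2 * PI * a) * cos (2 * PI * a))); [ring|rewrite Ha; ring]).
    rewrite E1, E2.
    transitivity (s * s * (sin (2 * PI * b) * sin (2 * PI * b)
             + cos (2 * PI * b) * cos (2 * PI * b))); [ring|rewrite Hb; ring]. }
  subst s. f_equal; apply Rmult_eq_reg_l with r; lra.
Qed.

Lemma continuous_integer_const (D : R -> R) (a b : R) :
  (forall x, continuous D x) -> (forall x, exists j : Z, D x = IZR j) -> D a = D b.
Proof.
  intros Hc HZ.
  assert (H : forall a b, ~ D a < D b).
  { clear a b. intros a b Hab.
    destruct (HZ a) as [i Hi]. destruct (HZ b) as [j Hj].
    assert (i < j)%Z by (apply lt_IZR; lra).
    assert (IZR i + 1 <= IZR j) by (rewrite <- plus_IZR; apply IZR_le; lia).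
    destruct (IVT_gen_consistent D a b (IZR i + 1 / 2) Hc) as [x [_ Hx]].
    { rewrite Rmin_left, Rmax_right; lra. }
    destruct (HZ x) as [k Hk]. rewrite Hk in Hx.
    assert (i < k)%Z by (apply lt_IZR; lra).
    assert (k < i + 1)%Z by (apply lt_IZR; rewrite plus_IZR; lra).
    lia. }
  pose proof (H a b). pose proof (H b a). lra.
Qed.

Lemma is_angle_lift_unique (A : R -> @matrix R 2 2) (psi psi' : R -> R -> R) :
  is_angle_lift A psi -> is_angle_lift A psi' ->
  exists j : Z, forall x y, psi' x y = psi x y + IZR j.
Proof.
  intros [C1 [_ [_ D1]]] [C2 [_ [_ D2]]].
  assert (HZ : forall x y, exists j : Z, psi' x y - psi x y = IZR j).
  { intros x y. destruct (D1 x y) as [r [Hr E1]]. destruct (D2 x y) as [s [Hs E2]].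
    rewrite E1 in E2. apply direction_scale_inj in E2; auto.
    apply direction_inj in E2. destruct E2 as [j Hj]. exists (- j)%Z. rewrite opp_IZR. lra. }
  destruct (HZ 0 0) as [j Hj]. exists j. intros x y.
  assert (E : psi' x y - psi x y = psi' 0 0 - psi 0 0); [|lra].
  pose proof (continuous_integer_const
    (fun t => psi' (t * x) (t * y) - psi (t * x) (t * y)) 1 0) as H.
  cbv beta in H. rewrite !Rmult_1_l, !Rmult_0_l in H. apply H; [|intro t; apply HZ].
  intro t. apply (continuous_minus (K := R_AbsRing) (V := R_NormedModule)).
  - apply (continuous_comp (fun t : R => (t * x, t * y)) (fun q : R * R => psi' (fst q) (snd q)));
      [|apply C2].
    apply (continuous_comp_2 (fun t : R => t * x) (fun t : R => t * y) (fun u v => (u, v)));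
      try apply (continuous_mult (K := R_AbsRing)); try apply continuous_id; try apply continuous_const.
    apply (continuous_ext (fun z : R * R => z)); [intros [? ?]; reflexivity|apply continuous_id].
  - apply (continuous_comp (fun t : R => (t * x, t * y)) (fun q : R * R => psi (fst q) (snd q)));
      [|apply C1].
    apply (continuous_comp_2 (fun t : R => t * x) (fun t : R => t * y) (fun u v => (u, v)));
      try apply (continuous_mult (K := R_AbsRing)); try apply continuous_id; try apply continuous_const.
    apply (continuous_ext (fun z : R * R => z)); [intros [? ?]; reflexivity|apply continuous_id].
Qed.

Lemma rho_spec (lambda : R) (f : R -> R) (alpha E : R) :
  irrational alpha -> (forall x, continuous f x) -> (forall x, f (x + 1) = f x) ->
  0 <= rho lambda f alpha E <= 1 / 2 /\ uniform_rotation lambda f alpha E (rho lambda f alpha E).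
Proof.
  intros Ha Hc Hp.
  destruct (uniform_rotation_exists lambda f alpha E Ha Hc Hp) as [r Hr].
  assert (H0 : 0 <= r).
  { rewrite <- (Rmult_1_l r). apply (uniform_rotation_ge lambda f alpha E r 1 0 0 0 (- 1 / 4) Hr).
    - lia.
    - intro j. rewrite Rmult_0_r, Rplus_0_r. apply lift_orbit_lower. }
  assert (H1 : r <= 1 / 2).
  { rewrite <- (Rmult_1_l r). apply (uniform_rotation_le lambda f alpha E r 1 0 0 (1 / 2) (1 / 4) Hr).
    - lia.
    - intro j. rewrite Nat.mul_1_r. apply lift_orbit_upper. }
  set (psi := fun x y => turn (E - lambda * f x) y).
  assert (Hpsi : is_angle_lift (S_real lambda f E) psi) by now apply is_angle_lift_turn.
  assert (Hlim : forall x y,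
    is_lim_seq (fun k => (angle_orbit alpha psi x y k - y) / INR k) r).
  { intros x y. apply is_lim_seq_spec. intros eps.
    destruct (Hr (eps / 2) ltac:(destruct eps; simpl; lra)) as [M0 HM].
    exists (S M0). intros k Hk. specialize (HM k x y ltac:(lia)).
    unfold psi. rewrite angle_orbit_lift.
    assert (HK : 0 < INR k) by (apply lt_0_INR; lia).
    match goal with |- Rabs (?u / INR k - r) < _ =>
      replace (u / INR k - r) with ((u - INR k * r) / INR k) by (field; lra) end.
    unfold Rdiv at 1. rewrite Rabs_mult, Rabs_inv, (Rabs_pos_eq (INR k)) by lra.
    apply Rmult_lt_reg_r with (INR k); [exact HK|].
    rewrite Rmult_assoc, Rinv_l by lra. destruct eps as [e He]; simpl in *. nra. }
  assert (Erho : rho lambda f alpha E = r).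
  { unfold rho. apply (iota_unique (K := R_AbsRing) (V := R_CompleteNormedModule)).
    - intros r' [Hr' [psi' [Hpsi' Hlim']]].
      destruct (is_angle_lift_unique _ _ _ Hpsi Hpsi') as [j Hj].
      assert (Horb : forall k, angle_orbit alpha psi' 0 0 k = angle_orbit alpha psi 0 0 k + INR k * IZR j).
      { induction k as [|k IH]; [simpl; ring|]. rewrite S_INR. simpl. rewrite IH, Hj.
        assert (Eper : psi (0 + INR k * alpha) (angle_orbit alpha psi 0 0 k + INR k * IZR j)
                = psi (0 + INR k * alpha) (angle_orbit alpha psi 0 0 k)); [|rewrite Eper; ring].
        destruct Hpsi as [_ [_ [P _]]].
        rewrite INR_IZR_INZ, <- mult_IZR.
        pose proof (periodic_Z (psi (0 + IZR (Z.of_nat k) * alpha)) 1 (Z.of_nat k * j)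
          (angle_orbit alpha psi 0 0 k) (P _)) as Q.
        rewrite Rmult_1_r in Q. exact Q. }
      assert (Hl : is_lim_seq (fun k => (angle_orbit alpha psi' 0 0 k - 0) / INR k) (r + IZR j)).
      { apply (is_lim_seq_ext_loc (fun k => (angle_orbit alpha psi 0 0 k - 0) / INR k + IZR j)).
        - exists 1%nat. intros k Hk. rewrite Horb.
          assert (0 < INR k) by (apply lt_0_INR; lia). field. lra.
        - apply is_lim_seq_plus'; [apply Hlim|apply is_lim_seq_const]. }
      apply is_lim_seq_unique in Hl. specialize (Hlim' 0 0). apply is_lim_seq_unique in Hlim'.
      rewrite Hl in Hlim'. injection Hlim' as Hlim'.
      assert (-1 < j)%Z by (apply lt_IZR; simpl; lra).
      assert (j < 1)%Z by (apply lt_IZR; simpl; lra).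
      replace j with 0%Z in Hlim' by lia. rewrite <- Hlim'. simpl. ring.
    - split; [lra|]. exists psi. auto. }
  rewrite Erho. split; [lra|exact Hr].
Qed.

(** * Gap edges *)

Lemma uniform_rotation_anti (lambda : R) (f : R -> R) (alpha E E' r r' : R) :
  uniform_rotation lambda f alpha E r -> uniform_rotation lambda f alpha E' r' ->
  E <= E' -> r' <= r.
Proof.
  intros Hr Hr' HE. apply Rnot_lt_le. intro Hlt.
  destruct (Hr ((r' - r) / 3) ltac:(lra)) as [M1 H1].
  destruct (Hr' ((r' - r) / 3) ltac:(lra)) as [M2 H2].
  set (M := S (max M1 M2)).
  specialize (H1 M 0 0 ltac:(lia)). specialize (H2 M 0 0 ltac:(lia)).
  assert (0 < INR M) by (apply lt_0_INR; lia).
  assert (lift_orbit (potential lambda f alpha E' 0) 0 M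
          <= lift_orbit (potential lambda f alpha E 0) 0 M).
  { apply lift_orbit_le; [|lra]. intro j. unfold potential. lra. }
  apply Rabs_le_between in H1. apply Rabs_le_between in H2. nra.
Qed.

(* Half-turns are needed in order to iterate: the lifts commute with them. *)
Lemma uniform_rotation_gain (lambda : R) (f : R -> R) (alpha E E' r r' : R) (L : nat) :
  uniform_rotation lambda f alpha E r -> uniform_rotation lambda f alpha E' r' ->
  (0 < L)%nat ->
  (forall x y, lift_orbit (potential lambda f alpha E x) y L + 1 / 2
               <= lift_orbit (potential lambda f alpha E' x) y L) ->
  r < r'.
Proof.
  intros Hr Hr' HL Hgain.
  assert (HL0 : 0 < INR L) by now apply lt_0_INR.
  assert (Hj : forall j, lift_orbit (potential lambda f alpha E 0) 0 (j * L) + INR j / 2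
               <= lift_orbit (potential lambda f alpha E' 0) 0 (j * L)).
  { induction j as [|j IH]; [simpl; lra|].
    rewrite S_INR. replace (S j * L)%nat with (j * L + L)%nat by lia.
    rewrite !potential_shift.
    pose proof (Hgain (0 + INR (j * L) * alpha)
      (lift_orbit (potential lambda f alpha E' 0) 0 (j * L))) as HG.
    pose proof (lift_orbit_le (potential lambda f alpha E (0 + INR (j * L) * alpha))
      (potential lambda f alpha E (0 + INR (j * L) * alpha)) _ _ L
      (fun i => Rle_refl _) IH) as HI.
    rewrite (INR_IZR_INZ j) in HI. rewrite lift_orbit_half, <- INR_IZR_INZ in HI. lra. }
  apply Rnot_le_lt. intro Hle.
  set (eps := / (8 * INR L)).
  assert (He : 0 < eps) by (apply Rinv_0_lt_compat; lra).
  assert (HeL : eps * INR L = 1 / 8) by (unfold eps; field; lra).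
  destruct (Hr eps He) as [M1 H1]. destruct (Hr' eps He) as [M2 H2].
  set (j := S (max M1 M2)). specialize (Hj j).
  specialize (H1 (j * L)%nat 0 0 ltac:(nia)). specialize (H2 (j * L)%nat 0 0 ltac:(nia)).
  rewrite mult_INR in *.
  assert (Hj0 : 0 < INR j) by (apply lt_0_INR; lia).
  replace (eps * (INR j * INR L)) with (INR j * (1 / 8)) in * by (rewrite <- HeL; ring).
  assert (INR j * INR L * r' <= INR j * INR L * r) by (apply Rmult_le_compat_l; nra).
  apply Rabs_le_between in H1. apply Rabs_le_between in H2. lra.
Qed.

Lemma uniform_rotation_continuous (lambda : R) (f : R -> R) (alpha E r : R) :
  (forall x, continuous f x) -> (forall x, f (x + 1) = f x) ->
  uniform_rotation lambda f alpha E r ->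
  forall eps, 0 < eps -> exists delta, 0 < delta /\ forall E' r',
    uniform_rotation lambda f alpha E' r' -> Rabs (E' - E) < delta -> Rabs (r' - r) < eps.
Proof.
  intros Hc Hp Hr eps He.
  destruct (periodic_bounded f Hc Hp) as [B HB].
  destruct (Hr (eps / 3) ltac:(lra)) as [M0 HM].
  set (M := S M0).
  assert (HMpos : 0 < INR M) by (apply lt_0_INR; lia).
  destruct (lift_orbit_unif (Rabs E + 1 + Rabs lambda * B) M (eps / 3 * INR M))
    as [d [Hd HU]]; [nra|].
  exists (Rmin d 1). split; [apply Rmin_pos; lra|]. intros E' r' Hr' HE.
  pose proof (Rmin_l d 1). pose proof (Rmin_r d 1).
  assert (HE' : Rabs E' <= Rabs E + 1).
  { replace E' with (E + (E' - E)) by ring. eapply Rle_trans; [apply Rabs_triang|]. lra. }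
  assert (Hblock : forall x y, Rabs (lift_orbit (potential lambda f alpha E' x) y M - y - INR M * r)
            <= 2 * eps / 3 * INR M).
  { intros x y. specialize (HM M x y ltac:(lia)).
    assert (HD : Rabs (lift_orbit (potential lambda f alpha E' x) y M
              - lift_orbit (potential lambda f alpha E x) y M) < eps / 3 * INR M).
    { apply HU.
      - intro j. now apply potential_bounded.
      - intro j. apply potential_bounded; [exact HB|lra].
      - intro j. unfold potential.
        match goal with |- Rabs ?u < _ => replace u with (E' - E) by ring end. lra.
      - rewrite Rminus_diag, Rabs_R0. exact Hd. }
    apply Rabs_lt_between in HD. apply Rabs_le_between in HM. apply Rabs_le_between. lra. }
  assert (Hj : forall j, Rabs (lift_orbit (potential lambda f alpha E' 0) 0 (j * M)
             - INR j * (INR M * r)) <= INR j * (2 * eps / 3 * INR M)).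
  { induction j as [|j IH].
    - simpl. rewrite !Rmult_0_l, Rminus_0_r, Rabs_R0. lra.
    - rewrite S_INR. replace (S j * M)%nat with (j * M + M)%nat by lia.
      rewrite potential_shift.
      pose proof (Hblock (0 + INR (j * M) * alpha)
        (lift_orbit (potential lambda f alpha E' 0) 0 (j * M))) as HB'.
      apply Rabs_le_between in HB'. apply Rabs_le_between in IH. apply Rabs_le_between. lra. }
  assert (H1 : INR M * r' <= INR M * r + 2 * eps / 3 * INR M).
  { apply (uniform_rotation_le lambda f alpha E' r' M 0 0 _ 0 Hr'); [lia|].
    intro j. specialize (Hj j). apply Rabs_le_between in Hj. lra. }
  assert (H2 : INR M * r - 2 * eps / 3 * INR M <= INR M * r').
  { apply (uniform_rotation_ge lambda f alpha E' r' M 0 0 _ 0 Hr'); [lia|].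
    intro j. specialize (Hj j). apply Rabs_le_between in Hj. lra. }
  apply Rabs_lt_between. split; apply Rmult_lt_reg_l with (INR M); nra.
Qed.

Lemma rho_anti (lambda : R) (f : R -> R) (alpha E E' : R) :
  irrational alpha -> (forall x, continuous f x) -> (forall x, f (x + 1) = f x) ->
  E <= E' -> rho lambda f alpha E' <= rho lambda f alpha E.
Proof.
  intros Ha Hc Hp HE.
  apply (uniform_rotation_anti lambda f alpha E E'); [now apply rho_spec..|exact HE].
Qed.

Lemma rho_continuous (lambda : R) (f : R -> R) (alpha : R) :
  irrational alpha -> (forall x, continuous f x) -> (forall x, f (x + 1) = f x) ->
  continuity (rho lambda f alpha).
Proof.
  intros Ha Hc Hp E eps He.
  destruct (uniform_rotation_continuous lambda f alpha E _ Hc Hp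
    (proj2 (rho_spec lambda f alpha E Ha Hc Hp)) eps He) as [d [Hd H]].
  exists d. split; [exact Hd|]. intros E' [_ HE]. simpl in *. unfold Rdist in *.
  apply (H E'); [now apply rho_spec|exact HE].
Qed.

Lemma rho_extremes (lambda : R) (f : R -> R) (alpha : R) :
  irrational alpha -> (forall x, continuous f x) -> (forall x, f (x + 1) = f x) ->
  exists B, 0 < B /\ (forall E, B <= E -> rho lambda f alpha E = 0) /\
    (forall E, E <= - B -> rho lambda f alpha E = 1 / 2).
Proof.
  intros Ha Hc Hp. destruct (periodic_bounded f Hc Hp) as [B HB].
  set (b := Rabs lambda * B).
  assert (Hb : forall E x j, E - b <= potential lambda f alpha E x j <= E + b).
  { intros E x j. unfold potential.
    assert (H : Rabs (lambda * f (x + INR j * alpha)) <= b).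
    { rewrite Rabs_mult. apply Rmult_le_compat_l; [apply Rabs_pos|apply HB]. }
    apply Rabs_le_between in H. lra. }
  assert (Hb0 : 0 <= b).
  { apply Rmult_le_pos; [apply Rabs_pos|]. apply Rle_trans with (Rabs (f 0)); [apply Rabs_pos|apply HB]. }
  exists (b + 2). split; [lra|]. split; intros E HE.
  - destruct (rho_spec lambda f alpha E Ha Hc Hp) as [H1 H2].
    assert (H : INR 1 * rho lambda f alpha E <= 0).
    { apply (uniform_rotation_le lambda f alpha E _ 1 0 (1 / 8) 0 (1 / 8) H2); [lia|].
      intro j. rewrite Rmult_0_r, Rplus_0_r. apply lift_orbit_diag.
      intro i. specialize (Hb E 0 i). lra. }
    simpl in H. lra.
  - destruct (rho_spec lambda f alpha E Ha Hc Hp) as [H1 H2].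
    assert (H : 1 / 2 <= INR 1 * rho lambda f alpha E).
    { apply (uniform_rotation_ge lambda f alpha E _ 1 0 (- 1 / 8) (1 / 2) (- 1 / 8) H2); [lia|].
      intro j. rewrite Nat.mul_1_r. apply lift_orbit_antidiag.
      intro i. specialize (Hb E 0 i). lra. }
    simpl in H. lra.
Qed.

Lemma gap_energies_level (lambda : R) (f : R -> R) (alpha : R) (m : Z) :
  irrational alpha -> (forall x, continuous f x) -> (forall x, f (x + 1) = f x) ->
  m <> 0%Z ->
  exists r, 0 < r < 1 / 2 /\
    forall E, gap_energies lambda f alpha m E <-> rho lambda f alpha E = r.
Proof.
  intros Ha Hc Hp Hm.
  destruct (archimed (IZR m * alpha)) as [H1 H2].
  set (j := (up (IZR m * alpha) - 1)%Z).
  assert (Hj : IZR j = IZR (up (IZR m * alpha)) - 1) by (unfold j; rewrite minus_IZR; reflexivity).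
  pose proof (irrational_mul alpha m j Ha Hm) as Hne.
  exists ((IZR m * alpha - IZR j) / 2). split; [lra|]. intro E. split.
  - intros [i Hi].
    destruct (rho_spec lambda f alpha E Ha Hc Hp) as [H3 _].
    assert (Hij : IZR (i + j) = 2 * rho lambda f alpha E - (IZR m * alpha - IZR j))
      by (rewrite plus_IZR; lra).
    assert (-1 < i + j)%Z by (apply lt_IZR; rewrite Hij; simpl; lra).
    assert (i + j < 1)%Z by (apply lt_IZR; rewrite Hij; simpl; lra).
    replace (i + j)%Z with 0%Z in Hij by lia. simpl in Hij. lra.
  - intros Hr. exists (- j)%Z. rewrite Hr, opp_IZR. lra.
Qed.

Lemma gap_edges (lambda : R) (f : R -> R) (alpha : R) (m : Z) :
  irrational alpha -> (forall x, continuous f x) -> (forall x, f (x + 1) = f x) ->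
  m <> 0%Z ->
  gap_energies lambda f alpha m (E_plus lambda f alpha m) /\
  (forall E, E_plus lambda f alpha m < E ->
     rho lambda f alpha E < rho lambda f alpha (E_plus lambda f alpha m)) /\
  (forall d, rho lambda f alpha (E_plus lambda f alpha m)
             < rho lambda f alpha (E_plus lambda f alpha m - d) ->
     E_plus lambda f alpha m - E_minus lambda f alpha m <= d).
Proof.
  intros Ha Hc Hp Hm.
  destruct (gap_energies_level lambda f alpha m Ha Hc Hp Hm) as [r [Hr Hg]].
  destruct (rho_extremes lambda f alpha Ha Hc Hp) as [B [HB [HB1 HB2]]].
  set (g := gap_energies lambda f alpha m) in *.
  pose proof (rho_continuous lambda f alpha Ha Hc Hp) as Hcont.
  assert (Hbd : forall E, g E -> - B <= E <= B).
  { intros E HE. apply Hg in HE. split; apply Rnot_lt_le; intro Hlt.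
    - rewrite HB2 in HE; lra.
    - rewrite HB1 in HE; lra. }
  destruct (IVT_gen (rho lambda f alpha) (- B) B r Hcont) as [E0 [_ HE0]].
  { rewrite (HB1 B), (HB2 (- B)) by lra. rewrite Rmin_right, Rmax_left; lra. }
  apply Hg in HE0.
  pose proof (Lub_Rbar_correct g) as [HL1 HL2].
  pose proof (Glb_Rbar_correct g) as [HG1 HG2].
  assert (HP : Lub_Rbar g = Finite (E_plus lambda f alpha m)).
  { unfold E_plus. fold g.
    assert (A1 := HL1 E0 HE0). assert (A2 := HL2 (Finite B) (fun x Hx => proj2 (Hbd x Hx))).
    destruct (Lub_Rbar g); simpl in *; tauto. }
  assert (HM : Glb_Rbar g = Finite (E_minus lambda f alpha m)).
  { unfold E_minus. fold g.
    assert (A1 := HG1 E0 HE0). assert (A2 := HG2 (Finite (- B)) (fun x Hx => proj1 (Hbd x Hx))).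
    destruct (Glb_Rbar g); simpl in *; tauto. }
  rewrite HP in HL1, HL2. rewrite HM in HG1, HG2.
  set (Ep := E_plus lambda f alpha m) in *. set (Em := E_minus lambda f alpha m) in *.
  assert (HEp : rho lambda f alpha Ep = r).
  { destruct (Req_dec (rho lambda f alpha Ep) r) as [H|H]; [exact H|exfalso].
    assert (He : 0 < Rabs (rho lambda f alpha Ep - r)) by (apply Rabs_pos_lt; lra).
    destruct (Hcont Ep _ He) as [d [Hd Hcl]].
    assert (A : Rbar_le (Finite Ep) (Finite (Ep - d))).
    { apply HL2. intros E HE. simpl. apply Rnot_lt_le. intro Hlt.
      assert (A := HL1 E HE). simpl in A.
      destruct (Req_dec Ep E) as [<-|Hne]; [apply Hg in HE; lra|].
      specialize (Hcl E). simpl in Hcl. unfold Rdist in Hcl.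
      apply Hg in HE. rewrite HE, (Rabs_minus_sym r) in Hcl.
      apply (Rlt_irrefl (Rabs (rho lambda f alpha Ep - r))). apply Hcl.
      split; [split; [exact I|exact Hne]|]. apply Rabs_lt_between. lra. }
    simpl in A. lra. }
  split; [|split].
  - now apply Hg.
  - intros E HE.
    pose proof (rho_anti lambda f alpha Ep E Ha Hc Hp ltac:(lra)) as [A|A]; [exact A|exfalso].
    assert (HgE : g E) by (apply Hg; lra). assert (A' := HL1 E HgE). simpl in A'. lra.
  - intros d Hd.
    assert (A : Rbar_le (Finite (Ep - d)) (Finite Em)).
    { apply HG2. intros E HE. simpl. apply Rnot_lt_le. intro Hlt.
      pose proof (rho_anti lambda f alpha E (Ep - d) Ha Hc Hp ltac:(lra)).
      apply Hg in HE. lra. }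
    simpl in A. lra.
Qed.

(** * Gap edges belong to the spectrum *)

(* The solution of u (k+1) + u (k-1) + c k * u k = e * u k with u 0 = 0, u 1 = 1. *)
Definition dirichlet (c : nat -> R) (e : R) (k : nat) : R :=
  snd (vec_orbit (fun j => e - c (S j)) (1, 0) k).

Lemma dirichlet_SS (c : nat -> R) (e : R) (k : nat) :
  dirichlet c e (S (S k)) = (e - c (S k)) * dirichlet c e (S k) - dirichlet c e k.
Proof. reflexivity. Qed.

Lemma dirichlet_wronskian (c : nat -> R) (e e' : R) (N : nat) :
  (e - e') * sum_f_R0 (fun k => dirichlet c e k * dirichlet c e' k) N
  = dirichlet c e (S N) * dirichlet c e' N - dirichlet c e N * dirichlet c e' (S N).
Proof.
  induction N as [|N IH].
  - unfold dirichlet; simpl. ring.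
  - rewrite tech5, Rmult_plus_distr_l, IH, !dirichlet_SS. ring.
Qed.

Lemma dirichlet_orthogonal (c : nat -> R) (e e' : R) (N : nat) :
  e <> e' -> dirichlet c e (S N) = 0 -> dirichlet c e' (S N) = 0 ->
  sum_f_R0 (fun k => dirichlet c e k * dirichlet c e' k) N = 0.
Proof.
  intros He H H'. pose proof (dirichlet_wronskian c e e' N) as W.
  rewrite H, H' in W. apply Rmult_eq_reg_l with (e - e'); lra.
Qed.

Lemma sum_sqr_comb3 (a b c : nat -> R) (x y z : R) (N : nat) :
  sum_f_R0 (fun k => (x * a k + y * b k + z * c k) ^ 2) N
  = x ^ 2 * sum_f_R0 (fun k => a k * a k) N + y ^ 2 * sum_f_R0 (fun k => b k * b k) N
    + z ^ 2 * sum_f_R0 (fun k => c k * c k) N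
    + 2 * x * y * sum_f_R0 (fun k => a k * b k) N
    + 2 * x * z * sum_f_R0 (fun k => a k * c k) N
    + 2 * y * z * sum_f_R0 (fun k => b k * c k) N.
Proof. induction N as [|N IH]; simpl; [ring|]. simpl in IH. rewrite IH. ring. Qed.

Lemma dirichlet_norm_ge1 (c : nat -> R) (e : R) (N : nat) :
  1 <= sum_f_R0 (fun k => dirichlet c e k * dirichlet c e k) (S N).
Proof.
  induction N as [|N IH].
  - unfold dirichlet; simpl. lra.
  - rewrite tech5. nra.
Qed.

(* Three Dirichlet eigenvectors on [1, N] admit a nonzero combination vanishing
   at both ends, so that cutting it off costs nothing. *)
Lemma dirichlet_trial (c : nat -> R) (E eps e1 e2 e3 : R) (N : nat) :
  E <= e1 <= E + eps -> E <= e2 <= E + eps -> E <= e3 <= E + eps ->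
  e1 <> e2 -> e1 <> e3 -> e2 <> e3 ->
  dirichlet c e1 (S (S N)) = 0 -> dirichlet c e2 (S (S N)) = 0 ->
  dirichlet c e3 (S (S N)) = 0 ->
  exists g h : nat -> R,
    (forall k, (S N < k)%nat -> g k = 0 /\ h k = 0) /\
    g 0%nat = 0 /\ g 1%nat = 0 /\ h 0%nat = 0 /\
    (forall k, g (S (S k)) + g k + (c (S k) - E) * g (S k) = h (S k)) /\
    0 < sum_f_R0 (fun k => g k ^ 2) (S N) /\
    sum_f_R0 (fun k => h k ^ 2) (S N) <= eps ^ 2 * sum_f_R0 (fun k => g k ^ 2) (S N).
Proof.
  intros He1 He2 He3 H12 H13 H23 Z1 Z2 Z3.
  set (d1 := dirichlet c e1). set (d2 := dirichlet c e2). set (d3 := dirichlet c e3).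
  assert (Hx : exists x1 x2 x3 : R, x1 + x2 + x3 = 0 /\
      x1 * d1 (S N) + x2 * d2 (S N) + x3 * d3 (S N) = 0 /\ 0 < x1 ^ 2 + x2 ^ 2 + x3 ^ 2).
  { destruct (Req_dec (d3 (S N)) (d2 (S N))) as [A|A].
    - exists 0, 1, (- 1). repeat split; lra.
    - exists (d3 (S N) - d2 (S N)), (d1 (S N) - d3 (S N)), (d2 (S N) - d1 (S N)).
      split; [ring|]. split; [ring|].
      assert (0 < (d3 (S N) - d2 (S N)) ^ 2) by (apply pow2_gt_0; lra).
      pose proof (pow2_ge_0 (d1 (S N) - d3 (S N))). pose proof (pow2_ge_0 (d2 (S N) - d1 (S N))).
      lra. }
  destruct Hx as [x1 [x2 [x3 [X1 [X2 X3]]]]].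
  set (G := fun k => x1 * d1 k + x2 * d2 k + x3 * d3 k).
  set (H := fun k => (x1 * (e1 - E)) * d1 k + (x2 * (e2 - E)) * d2 k + (x3 * (e3 - E)) * d3 k).
  exists (fun k => if Nat.leb k (S N) then G k else 0),
         (fun k => if Nat.leb k (S N) then H k else 0).
  assert (G0 : G 0%nat = 0) by (unfold G, d1, d2, d3, dirichlet; simpl; ring).
  assert (G1 : G 1%nat = 0) by (unfold G, d1, d2, d3, dirichlet; simpl; lra).
  assert (H0 : H 0%nat = 0) by (unfold H, d1, d2, d3, dirichlet; simpl; ring).
  assert (GN : G (S N) = 0) by exact X2.
  assert (GN' : G (S (S N)) = 0).
  { unfold G. fold d1 in Z1. fold d2 in Z2. fold d3 in Z3. rewrite Z1, Z2, Z3. ring. }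
  assert (Rec : forall k, G (S (S k)) + G k + (c (S k) - E) * G (S k) = H (S k)).
  { intro k. unfold G, H, d1, d2, d3. rewrite !dirichlet_SS. ring. }
  assert (ES : forall F : nat -> R,
     sum_f_R0 (fun k => (if Nat.leb k (S N) then F k else 0) ^ 2) (S N)
     = sum_f_R0 (fun k => F k ^ 2) (S N)).
  { intro F. apply sum_eq. intros k Hk. apply Nat.leb_le in Hk. now rewrite Hk. }
  split; [|split; [|split; [|split; [|split]]]].
  - intros k Hk. assert (A : Nat.leb k (S N) = false) by (apply Nat.leb_gt; exact Hk).
    now rewrite A.
  - exact G0.
  - exact G1.
  - exact H0.
  - intro k. destruct (lt_eq_lt_dec k N) as [[Hk|Hk]|Hk].
    + assert (A1 : Nat.leb (S (S k)) (S N) = true) by (apply Nat.leb_le; lia).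
      assert (A2 : Nat.leb (S k) (S N) = true) by (apply Nat.leb_le; lia).
      assert (A3 : Nat.leb k (S N) = true) by (apply Nat.leb_le; lia).
      rewrite A1, A2, A3. apply Rec.
    + subst k.
      assert (A1 : Nat.leb (S (S N)) (S N) = false) by (apply Nat.leb_gt; lia).
      assert (A2 : Nat.leb (S N) (S N) = true) by (apply Nat.leb_le; lia).
      assert (A3 : Nat.leb N (S N) = true) by (apply Nat.leb_le; lia).
      rewrite A1, A2, A3, <- Rec, GN'. reflexivity.
    + assert (A1 : Nat.leb (S (S k)) (S N) = false) by (apply Nat.leb_gt; lia).
      assert (A2 : Nat.leb (S k) (S N) = false) by (apply Nat.leb_gt; lia).
      rewrite A1, A2.
      destruct (Nat.eq_dec k (S N)) as [->|Hk'].
      * assert (A3 : Nat.leb (S N) (S N) = true) by (apply Nat.leb_le; lia).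
        rewrite A3, GN. ring.
      * assert (A3 : Nat.leb k (S N) = false) by (apply Nat.leb_gt; lia).
        rewrite A3. ring.
  - rewrite !ES. unfold G, H. rewrite !sum_sqr_comb3.
    unfold d1, d2, d3. rewrite (dirichlet_orthogonal c e1 e2), (dirichlet_orthogonal c e1 e3),
      (dirichlet_orthogonal c e2 e3) by assumption.
    pose proof (dirichlet_norm_ge1 c e1 N) as S1. pose proof (dirichlet_norm_ge1 c e2 N) as S2.
    pose proof (dirichlet_norm_ge1 c e3 N) as S3.
    set (s1 := sum_f_R0 (fun k => dirichlet c e1 k * dirichlet c e1 k) (S N)) in *.
    set (s2 := sum_f_R0 (fun k => dirichlet c e2 k * dirichlet c e2 k) (S N)) in *.
    set (s3 := sum_f_R0 (fun k => dirichlet c e3 k * dirichlet c e3 k) (S N)) in *.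
    pose proof (pow2_ge_0 x1). pose proof (pow2_ge_0 x2). pose proof (pow2_ge_0 x3).
    split; [nra|].
    assert (A : forall x e s, E <= e <= E + eps -> 1 <= s ->
              (x * (e - E)) ^ 2 * s <= eps ^ 2 * (x ^ 2 * s)).
    { intros x e s He Hs.
      replace ((x * (e - E)) ^ 2 * s) with ((e - E) ^ 2 * (x ^ 2 * s)) by ring.
      apply Rmult_le_compat_r.
      - apply Rmult_le_pos; [apply pow2_ge_0|lra].
      - apply pow_incr. lra. }
    pose proof (A x1 e1 s1 He1 S1). pose proof (A x2 e2 s2 He2 S2). pose proof (A x3 e3 s3 He3 S3).
    lra.
Qed.

Lemma cos_vertical (j : Z) : cos (2 * PI * (1 / 4 + IZR j / 2)) = 0.
Proof. apply cos_eq_0_1. exists j. field. Qed.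

Lemma dirichlet_zero (c : nat -> R) (e : R) (N : nat) (j : Z) :
  lift_orbit (fun i => e - c (S i)) 0 N = 1 / 4 + IZR j / 2 -> dirichlet c e (S N) = 0.
Proof.
  intros HL. destruct (vec_orbit_lift (fun i => e - c (S i)) 0 N) as [r [_ Hr]].
  rewrite HL in Hr. unfold direction in Hr. rewrite Rmult_0_r, cos_0, sin_0 in Hr.
  change (dirichlet c e (S N)) with (fst (vec_orbit (fun i => e - c (S i)) (1, 0) N)).
  rewrite Hr; cbn [fst snd]. rewrite cos_vertical. ring.
Qed.

Definition embed (g : nat -> R) (n : Z) : C :=
  if Z.ltb n 0 then RtoC 0 else RtoC (g (Z.to_nat n)).

Lemma embed_of_nat (g : nat -> R) (k : nat) : embed g (Z.of_nat k) = RtoC (g k).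
Proof.
  unfold embed. assert (A : Z.ltb (Z.of_nat k) 0 = false) by (apply Z.ltb_ge; lia).
  now rewrite A, Nat2Z.id.
Qed.

Lemma embed_neg (g : nat -> R) (n : Z) : (n < 0)%Z -> embed g n = RtoC 0.
Proof. intros H. unfold embed. apply Z.ltb_lt in H. now rewrite H. Qed.

Lemma is_series_finite (a : nat -> R) (N : nat) :
  (forall k, (N < k)%nat -> a k = 0) -> is_series a (sum_f_R0 a N).
Proof.
  intros Ha.
  change (is_lim_seq (fun n => sum_n a n) (Finite (sum_f_R0 a N))).
  apply (is_lim_seq_ext_loc (fun _ => sum_f_R0 a N)); [|apply is_lim_seq_const].
  exists N. intros n Hn. rewrite sum_n_Reals. induction Hn as [|n Hn IH]; [reflexivity|].
  rewrite tech5, <- IH, Ha by lia. ring.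
Qed.

Lemma embed_series (g : nat -> R) (N : nat) :
  (forall k, (N < k)%nat -> g k = 0) ->
  is_series (fun k => Cmod (embed g (Z.of_nat k)) ^ 2) (sum_f_R0 (fun k => g k ^ 2) N) /\
  is_series (fun k => Cmod (embed g (- Z.of_nat (S k))%Z) ^ 2) 0.
Proof.
  intros Hg. split.
  - apply (is_series_ext (fun k => g k ^ 2)).
    + intro k. rewrite embed_of_nat, Cmod_R. now rewrite pow2_abs.
    + apply is_series_finite. intros k Hk. rewrite Hg by exact Hk. ring.
  - change 0 with (sum_f_R0 (fun _ => 0) 0).
    apply (is_series_ext (fun _ => 0)).
    + intro k. rewrite embed_neg by lia. rewrite Cmod_0. symmetry. apply pow_i. lia.
    + now apply is_series_finite.
Qed.

Lemma embed_in_l2 (g : nat -> R) (N : nat) :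
  (forall k, (N < k)%nat -> g k = 0) -> in_l2 (embed g).
Proof. intros Hg. destruct (embed_series g N Hg). split; eexists; eassumption. Qed.

Lemma l2_norm_embed (g : nat -> R) (N : nat) :
  (forall k, (N < k)%nat -> g k = 0) ->
  l2_norm (embed g) = sqrt (sum_f_R0 (fun k => g k ^ 2) N).
Proof.
  intros Hg. destruct (embed_series g N Hg) as [H1 H2].
  apply is_series_unique in H1. apply is_series_unique in H2.
  unfold l2_norm. rewrite H1, H2. f_equal. ring.
Qed.

Lemma l2_norm_ext (x y : Z -> C) : (forall n, x n = y n) -> l2_norm x = l2_norm y.
Proof.
  intros H. unfold l2_norm. f_equal. f_equal; apply Series_ext; intro; now rewrite H.
Qed.

Lemma in_l2_ext (x y : Z -> C) : (forall n, x n = y n) -> in_l2 x -> in_l2 y.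
Proof.
  intros H [[l1 H1] [l2 H2]]. split; [exists l1|exists l2];
    [revert H1|revert H2]; apply is_series_ext; intro; now rewrite H.
Qed.

Lemma schrodinger_embed (lambda : R) (f : R -> R) (alpha theta E : R) (g h : nat -> R) :
  g 0%nat = 0 -> g 1%nat = 0 -> h 0%nat = 0 ->
  (forall k, g (S (S k)) + g k + (lambda * f (theta + INR (S k) * alpha) - E) * g (S k) = h (S k)) ->
  forall n, embed h n
    = (schrodinger_op lambda f alpha theta (embed g) n - RtoC E * embed g n)%C.
Proof.
  intros G0 G1 H0 Hrec n. unfold schrodinger_op.
  destruct (Z_lt_le_dec n 0) as [Hn|Hn].
  - rewrite !(embed_neg _ n), (embed_neg _ (n - 1)) by lia.
    destruct (Z.eq_dec n (- 1)) as [->|Hne].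
    + change (- 1 + 1)%Z with (Z.of_nat 0). rewrite embed_of_nat, G0. ring.
    + rewrite embed_neg by lia. ring.
  - destruct (Z_of_nat_complete n Hn) as [[|k] ->].
    + change (Z.of_nat 0 + 1)%Z with (Z.of_nat 1). rewrite !embed_of_nat, embed_neg by lia.
      rewrite G0, G1, H0. ring.
    + replace (Z.of_nat (S k) + 1)%Z with (Z.of_nat (S (S k))) by lia.
      replace (Z.of_nat (S k) - 1)%Z with (Z.of_nat k) by lia.
      rewrite !embed_of_nat, <- Hrec, <- INR_IZR_INZ.
      apply injective_projections; cbn -[INR]; ring.
Qed.

Lemma Sigma_of_rho_decreasing (lambda : R) (f : R -> R) (alpha E : R) :
  irrational alpha -> (forall x, continuous f x) -> (forall x, f (x + 1) = f x) ->
  (forall E', E < E' -> rho lambda f alpha E' < rho lambda f alpha E) ->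
  Sigma lambda f alpha E.
Proof.
  intros Ha Hc Hp Hdec theta [G [K [HG1 HG2]]].
  set (eps := / (2 * (Rabs K + 1))).
  pose proof (Rabs_pos K) as HK.
  assert (He : 0 < eps) by (apply Rinv_0_lt_compat; lra).
  set (c := fun k => lambda * f (theta + INR k * alpha)).
  set (D := fun e N => lift_orbit (fun i => e - c (S i)) 0 N).
  assert (HDp : forall e N, D e N = lift_orbit (potential lambda f alpha e (theta + alpha)) 0 N).
  { intros e N. apply lift_orbit_ext. intro j. unfold c, potential. rewrite S_INR.
    do 3 f_equal. ring. }
  pose proof (Hdec (E + eps) ltac:(lra)) as Hlt.
  set (gam := rho lambda f alpha E - rho lambda f alpha (E + eps)).
  assert (Hgam : 0 < gam) by (unfold gam; lra).
  destruct (rho_spec lambda f alpha E Ha Hc Hp) as [_ R1].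
  destruct (rho_spec lambda f alpha (E + eps) Ha Hc Hp) as [_ R2].
  destruct (R1 (gam / 3) ltac:(lra)) as [M1 HM1].
  destruct (R2 (gam / 3) ltac:(lra)) as [M2 HM2].
  destruct (ex_INR_ge (6 / gam)) as [M3 [_ HM3]].
  set (N := (M1 + M2 + M3)%nat).
  specialize (HM1 (S N) (theta + alpha) 0 ltac:(unfold N; lia)).
  specialize (HM2 (S N) (theta + alpha) 0 ltac:(unfold N; lia)).
  rewrite <- HDp in HM1, HM2.
  assert (HD2 : D (E + eps) (S N) + 2 <= D E (S N)).
  { assert (INR M3 <= INR (S N)) by (apply le_INR; unfold N; lia).
    apply Rmult_le_compat_r with (r := gam / 3) in HM3; [|lra].
    replace (6 / gam * (gam / 3)) with 2 in HM3 by (field; lra).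
    assert (INR M3 * (gam / 3) <= INR (S N) * (gam / 3)) by (apply Rmult_le_compat_r; lra).
    apply Rabs_le_between in HM1. apply Rabs_le_between in HM2.
    assert (INR (S N) * rho lambda f alpha E
            = INR (S N) * rho lambda f alpha (E + eps) + INR (S N) * gam) by (unfold gam; ring).
    lra. }
  destruct (half_translate (D (E + eps) (S N)) (1 / 4)) as [j Hj].
  assert (HIVT : forall i : Z, (0 <= i <= 2)%Z -> exists e, E <= e <= E + eps /\
            D e (S N) = 1 / 4 + IZR (j + i) / 2).
  { intros i [Hi1 Hi2]. apply IZR_le in Hi1, Hi2.
    destruct (IVT_gen_consistent (fun e => D e (S N)) E (E + eps) (1 / 4 + IZR (j + i) / 2))
      as [e [He1 He2]].
    - intro x. apply (continuous_lift_orbit _ (fun e i => e - c (S i)) (fun _ => 0));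
        [|apply continuous_const].
      intro k. apply (continuous_minus (K := R_AbsRing) (V := R_NormedModule));
        [apply continuous_id|apply continuous_const].
    - rewrite Rmin_right, Rmax_left by lra. rewrite plus_IZR. simpl in *. lra.
    - exists e. rewrite Rmin_left, Rmax_right in He1 by lra. auto. }
  destruct (HIVT 0%Z ltac:(lia)) as [e1 [B1 D1]].
  destruct (HIVT 1%Z ltac:(lia)) as [e2 [B2 D2]].
  destruct (HIVT 2%Z ltac:(lia)) as [e3 [B3 D3]].
  destruct (dirichlet_trial c E eps e1 e2 e3 N) as [g [h [Hsup [G0 [G1 [H0 [Hrec [Hpos Hle]]]]]]]];
    try assumption.
  1-3: intros ->; rewrite ?D1, ?D2, !plus_IZR in *; lra.
  1: exact (dirichlet_zero c e1 _ _ D1).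
  1: exact (dirichlet_zero c e2 _ _ D2).
  1: exact (dirichlet_zero c e3 _ _ D3).
  pose proof (schrodinger_embed lambda f alpha theta E g h G0 G1 H0 Hrec) as Hop.
  assert (Hg : in_l2 (embed g)) by (apply (embed_in_l2 g (S N)); intros; now apply Hsup).
  assert (Hh : in_l2 (embed h)) by (apply (embed_in_l2 h (S N)); intros; now apply Hsup).
  destruct (HG1 _ (in_l2_ext _ _ Hop Hh)) as [_ [HGn _]].
  rewrite (l2_norm_ext _ _ (HG2 (embed g) Hg)), <- (l2_norm_ext _ _ Hop) in HGn.
  rewrite (l2_norm_embed g (S N)), (l2_norm_embed h (S N)) in HGn by (intros; now apply Hsup).
  set (sg := sum_f_R0 (fun k => g k ^ 2) (S N)) in *.
  set (sh := sum_f_R0 (fun k => h k ^ 2) (S N)) in *.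
  assert (Hs : sqrt sh <= eps * sqrt sg).
  { rewrite <- (sqrt_pow2 eps) by lra. rewrite <- sqrt_mult_alt by (apply pow2_ge_0).
    now apply sqrt_le_1_alt. }
  assert (0 < sqrt sg) by now apply sqrt_lt_R0.
  pose proof (sqrt_pos sh). pose proof (Rle_abs K).
  assert (HKe : (Rabs K + 1) * eps = 1 / 2) by (unfold eps; field; lra).
  assert (K * sqrt sh <= (Rabs K + 1) * (eps * sqrt sg)).
  { apply Rle_trans with ((Rabs K + 1) * sqrt sh); [apply Rmult_le_compat_r; lra|].
    apply Rmult_le_compat_l; lra. }
  rewrite <- Rmult_assoc, HKe in H3. lra.
Qed.

(** * Bounded transfer matrices force rotation *)

Definition nsq (v : R * R) : R := fst v * fst v + snd v * snd v.

Lemma vec_orbit_linear (w : nat -> R) (a b : R) (k : nat) :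
  vec_orbit w (a, b) k
  = (a * fst (vec_orbit w (1, 0) k) + b * fst (vec_orbit w (0, 1) k),
     a * snd (vec_orbit w (1, 0) k) + b * snd (vec_orbit w (0, 1) k)).
Proof.
  induction k as [|k IH]; simpl; [f_equal; ring|]. rewrite IH. unfold step; simpl.
  f_equal; ring.
Qed.

Lemma vec_orbit_cross (w : nat -> R) (k : nat) :
  cross (vec_orbit w (1, 0) k) (vec_orbit w (0, 1) k) = 1.
Proof.
  induction k as [|k IH]; simpl; [unfold cross; simpl; ring|]. now rewrite cross_step.
Qed.

Lemma cross_sqr_le (u v : R * R) : cross u v * cross u v <= nsq u * nsq v.
Proof.
  unfold cross, nsq. destruct u as [a b], v as [c e]; simpl.
  pose proof (Rle_0_sqr (a * c + b * e)) as H. unfold Rsqr in H. nra.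
Qed.

(* The orbit of [v] at the perturbed energy, pulled back by the unperturbed
   transfer matrix with columns [p] and [q]. *)
Definition pulled_back (w : nat -> R) (d : R) (v : R * R) (k : nat) : R * R :=
  let u := vec_orbit (fun j => w j - d) v k in
  (cross u (vec_orbit w (0, 1) k), cross (vec_orbit w (1, 0) k) u).

Lemma pulled_back_lift (w : nat -> R) (d y z : R) (k : nat) :
  lift_orbit w z k = lift_orbit (fun j => w j - d) y k ->
  exists n, 0 < n /\ pulled_back w d (direction y) k
                     = (n * fst (direction z), n * snd (direction z)).
Proof.
  intros HL.
  destruct (vec_orbit_lift w z k) as [r [Hr E1]].
  destruct (vec_orbit_lift (fun j => w j - d) y k) as [s [Hs E2]].
  rewrite HL in E1. exists (s / r). split; [now apply Rdiv_lt_0_compat|].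
  set (D := direction (lift_orbit (fun j => w j - d) y k)) in *.
  assert (E3 : vec_orbit (fun j => w j - d) (direction y) k
     = (s / r * fst (vec_orbit w (direction z) k), s / r * snd (vec_orbit w (direction z) k))).
  { rewrite E1, E2. cbn [fst snd]. apply injective_projections; cbn [fst snd]; field; lra. }
  rewrite (surjective_pairing (direction z)), vec_orbit_linear in E3.
  pose proof (vec_orbit_cross w k) as HX.
  unfold pulled_back. rewrite E3. unfold cross in *. cbn [fst snd] in *.
  set (p := vec_orbit w (1, 0) k) in *. set (q := vec_orbit w (0, 1) k) in *.
  apply injective_projections; cbn [fst snd].
  - transitivity (s / r * fst (direction z) * (fst p * snd q - snd p * fst q)); [ring|].
    rewrite HX. ring.
  - transitivity (s / r * snd (direction z) * (fst p * snd q - snd p * fst q)); [ring|].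
    rewrite HX. ring.
Qed.

Lemma pulled_back_S (w : nat -> R) (d : R) (v : R * R) (k : nat) :
  let a := fst (vec_orbit (fun j => w j - d) v k) in
  pulled_back w d v (S k)
  = (fst (pulled_back w d v k) - d * a * fst (vec_orbit w (0, 1) k),
     snd (pulled_back w d v k) + d * a * fst (vec_orbit w (1, 0) k)).
Proof.
  unfold pulled_back, cross; simpl. unfold step; simpl. f_equal; ring.
Qed.

Lemma pulled_back_fst (w : nat -> R) (d : R) (v : R * R) (k : nat) :
  fst (vec_orbit (fun j => w j - d) v k)
  = fst (pulled_back w d v k) * fst (vec_orbit w (1, 0) k)
    + snd (pulled_back w d v k) * fst (vec_orbit w (0, 1) k).
Proof.
  pose proof (vec_orbit_cross w k) as HX. unfold pulled_back, cross in *. cbn [fst snd].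
  set (p := vec_orbit w (1, 0) k) in *. set (q := vec_orbit w (0, 1) k) in *.
  set (u := vec_orbit (fun j => w j - d) v k).
  transitivity (fst u * (fst p * snd q - snd p * fst q)); [rewrite HX; ring|ring].
Qed.

Lemma nsq_pos (v : R * R) : 0 <= nsq v.
Proof. unfold nsq. nra. Qed.

Lemma nsq_direction (n z : R) : nsq (n * fst (direction z), n * snd (direction z)) = n * n.
Proof.
  unfold nsq, direction; cbn [fst snd].
  pose proof (sin_cos_sqr (2 * PI * z)) as H.
  transitivity (n * n * (sin (2 * PI * z) * sin (2 * PI * z) + cos (2 * PI * z) * cos (2 * PI * z)));
    [ring|rewrite H; ring].
Qed.

Lemma pulled_back_step (w : nat -> R) (d Q y z z' n n' : R) (k : nat) :
  0 < d -> 4 * d * Q <= 1 ->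
  nsq (vec_orbit w (1, 0) k) <= Q -> nsq (vec_orbit w (0, 1) k) <= Q ->
  lift_orbit w z k = lift_orbit (fun j => w j - d) y k ->
  lift_orbit w z' (S k) = lift_orbit (fun j => w j - d) y (S k) ->
  0 < n -> 0 < n' ->
  pulled_back w d (direction y) k = (n * fst (direction z), n * snd (direction z)) ->
  pulled_back w d (direction y) (S k) = (n' * fst (direction z'), n' * snd (direction z')) ->
  let a := fst (vec_orbit (fun j => w j - d) (direction y) k) in
  z <= z' /\ n <= 2 * n' /\ n' <= 2 * n /\ d * (a * a) <= n * n' * (2 * PI * (z' - z)).
Proof.
  intros Hd HdQ Hp Hq Hz Hz' Hn Hn' E E' a.
  pose proof (pulled_back_S w d (direction y) k) as HS. cbv zeta in HS. fold a in HS.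
  pose proof (pulled_back_fst w d (direction y) k) as HF. fold a in HF.
  assert (Hzz : z <= z').
  { apply Rnot_lt_le. intro Hlt.
    pose proof (lift_orbit_lt w z' z (S k) Hlt) as A. rewrite Hz' in A.
    cbn [lift_orbit] in A. rewrite Hz in A.
    pose proof (lift_step_anti (w k) (w k - d)
      (lift_orbit (fun j => w j - d) y k) ltac:(lra)). lra. }
  set (p1 := fst (vec_orbit w (1, 0) k)) in *. set (q1 := fst (vec_orbit w (0, 1) k)) in *.
  assert (Hp1 : p1 * p1 <= Q).
  { unfold nsq in Hp. fold p1 in Hp. pose proof (Rle_0_sqr (snd (vec_orbit w (1, 0) k))) as A.
    unfold Rsqr in A. lra. }
  assert (Hq1 : q1 * q1 <= Q).
  { unfold nsq in Hq. fold q1 in Hq. pose proof (Rle_0_sqr (snd (vec_orbit w (0, 1) k))) as A.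
    unfold Rsqr in A. lra. }
  pose proof (nsq_direction n z) as N1. rewrite <- E in N1.
  pose proof (nsq_direction n' z') as N2. rewrite <- E' in N2.
  assert (HC : cross (pulled_back w d (direction y) k) (pulled_back w d (direction y) (S k))
               = n * n' * sin (2 * PI * (z' - z))).
  { rewrite E, E', <- cross_direction. unfold cross; cbn [fst snd]. ring. }
  assert (Hdot : n * n' * cos (2 * PI * (z' - z))
     = fst (pulled_back w d (direction y) k) * fst (pulled_back w d (direction y) (S k))
       + snd (pulled_back w d (direction y) k) * snd (pulled_back w d (direction y) (S k))).
  { rewrite E, E'. unfold direction; cbn [fst snd].
    replace (2 * PI * (z' - z)) with (2 * PI * z' - 2 * PI * z) by ring.
    rewrite cos_minus. ring. }
  rewrite HS in N2, HC, Hdot.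
  set (x := fst (pulled_back w d (direction y) k)) in *.
  set (t := snd (pulled_back w d (direction y) k)) in *.
  unfold nsq, cross in *; cbn [fst snd] in *. fold x t in N1, HC.
  assert (HC' : d * (a * a) = n * n' * sin (2 * PI * (z' - z))).
  { rewrite <- HC. transitivity (d * a * (x * p1 + t * q1)); [rewrite <- HF; ring|ring]. }
  assert (Ha2 : a * a <= 2 * Q * (n * n)).
  { rewrite HF, <- N1.
    pose proof (Rle_0_sqr (x * q1 - t * p1)) as A. unfold Rsqr in A.
    apply Rle_trans with ((x * x + t * t) * (p1 * p1 + q1 * q1)); [lra|].
    rewrite Rmult_comm. apply Rmult_le_compat_r; [nra|lra]. }
  assert (HQ0 : 0 <= Q) by (pose proof (Rle_0_sqr p1) as A; unfold Rsqr in A; lra).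
  assert (Hdiff : (n' - n) * (n' - n) <= n * n / 4).
  { pose proof (COS_bound (2 * PI * (z' - z))) as [_ Hcos].
    assert (A : n * n' * cos (2 * PI * (z' - z)) <= n * n').
    { rewrite <- (Rmult_1_r (n * n')) at 2. apply Rmult_le_compat_l; nra. }
    rewrite Hdot in A.
    apply Rle_trans with ((d * a * q1) * (d * a * q1) + (d * a * p1) * (d * a * p1)); [nra|].
    replace ((d * a * q1) * (d * a * q1) + (d * a * p1) * (d * a * p1))
      with (d * d * (a * a) * (p1 * p1 + q1 * q1)) by ring.
    apply Rle_trans with (d * d * (2 * Q * (n * n)) * (2 * Q)).
    - apply Rmult_le_compat; nra.
    - replace (d * d * (2 * Q * (n * n)) * (2 * Q)) with ((4 * d * Q) * (4 * d * Q) * (n * n / 4)) by field.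
      rewrite <- (Rmult_1_l (n * n / 4)) at 2. apply Rmult_le_compat_r; [nra|].
      assert (0 <= 4 * d * Q) by (apply Rmult_le_pos; lra). nra. }
  split; [exact Hzz|]. split; [nra|]. split; [nra|].
  rewrite HC'. apply Rmult_le_compat_l; [nra|].
  pose proof PI_RGT_0.
  destruct Hzz as [Hlt| ->].
  - left. apply sin_lt_x. apply Rmult_lt_0_compat; lra.
  - rewrite Rminus_diag, Rmult_0_r, sin_0. lra.
Qed.

Lemma pulled_back_nsq (w : nat -> R) (d Q : R) (v : R * R) (k : nat) :
  nsq (vec_orbit w (1, 0) k) <= Q -> nsq (vec_orbit w (0, 1) k) <= Q ->
  nsq (pulled_back w d v k) <= 2 * Q * nsq (vec_orbit (fun j => w j - d) v k).
Proof.
  intros Hp Hq.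
  set (u := vec_orbit (fun j => w j - d) v k).
  pose proof (cross_sqr_le u (vec_orbit w (0, 1) k)) as A1.
  pose proof (cross_sqr_le (vec_orbit w (1, 0) k) u) as A2.
  pose proof (nsq_pos u) as A3.
  unfold pulled_back. fold u. unfold nsq at 1; cbn [fst snd].
  assert (nsq u * nsq (vec_orbit w (0, 1) k) <= nsq u * Q) by (apply Rmult_le_compat_l; lra).
  assert (nsq (vec_orbit w (1, 0) k) * nsq u <= Q * nsq u) by (apply Rmult_le_compat_r; lra).
  lra.
Qed.

(* Bounded transfer matrices at energy [E] over a long time force the pulled
   back angle at energy [E - d] to advance at a definite rate: one step gains
   [d a^2] in cross product, [a] being the entry of the solution, and two
   consecutive entries cannot both be small. *)
Lemma lift_gain (w : nat -> R) (d Q y : R) (J : nat) :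
  0 < d -> 4 * d * Q <= 1 ->
  (forall k, (k <= 2 * J)%nat ->
     nsq (vec_orbit w (1, 0) k) <= Q /\ nsq (vec_orbit w (0, 1) k) <= Q) ->
  4 * PI * Q <= INR J * d ->
  lift_orbit w y (2 * J) + 1 / 2 <= lift_orbit (fun j => w j - d) y (2 * J).
Proof.
  intros Hd HdQ HQ HJ. pose proof PI_RGT_0 as HPI.
  assert (HQ1 : 1 <= Q).
  { destruct (HQ 0%nat ltac:(lia)) as [A _]. unfold nsq in A; simpl in A. lra. }
  set (g := d / (8 * PI * Q)).
  assert (HPQ : 0 < PI * Q) by (apply Rmult_lt_0_compat; lra).
  assert (H : forall j, (j <= J)%nat -> exists z,
     lift_orbit w z (2 * j) = lift_orbit (fun i => w i - d) y (2 * j) /\ y + INR j * g <= z).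
  { induction j as [|j IH]; intros Hj.
    - exists y. split; [reflexivity|]. simpl. lra.
    - destruct (IH ltac:(lia)) as [z [Hz Hyz]].
      replace (2 * S j)%nat with (S (S (2 * j))) by lia.
      set (k := (2 * j)%nat) in *.
      destruct (lift_orbit_surj w (S k) (lift_orbit (fun i => w i - d) y (S k))) as [z1 Hz1].
      destruct (lift_orbit_surj w (S (S k)) (lift_orbit (fun i => w i - d) y (S (S k)))) as [z2 Hz2].
      destruct (pulled_back_lift w d y z k Hz) as [n0 [Hn0 E0]].
      destruct (pulled_back_lift w d y z1 (S k) Hz1) as [n1 [Hn1 E1]].
      destruct (pulled_back_lift w d y z2 (S (S k)) Hz2) as [n2 [Hn2 E2]].
      destruct (HQ k ltac:(unfold k; lia)) as [P0 Q0].
      destruct (HQ (S k) ltac:(unfold k; lia)) as [P1 Q1].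
      destruct (pulled_back_step w d Q y z z1 n0 n1 k Hd HdQ P0 Q0 Hz Hz1 Hn0 Hn1 E0 E1)
        as [Z1 [N1 [_ G1]]].
      destruct (pulled_back_step w d Q y z1 z2 n1 n2 (S k) Hd HdQ P1 Q1 Hz1 Hz2 Hn1 Hn2 E1 E2)
        as [Z2 [_ [N2 G2]]].
      pose proof (pulled_back_nsq w d Q (direction y) (S k) P1 Q1) as B.
      rewrite E1, nsq_direction in B. unfold nsq in B.
      set (a1 := fst (vec_orbit (fun i => w i - d) (direction y) (S k))) in *.
      change (snd (vec_orbit (fun i => w i - d) (direction y) (S k)))
        with (fst (vec_orbit (fun i => w i - d) (direction y) k)) in B.
      set (a0 := fst (vec_orbit (fun i => w i - d) (direction y) k)) in *.
      exists z2. split; [exact Hz2|].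
      assert (HG : g <= z2 - z).
      { assert (T1 : n0 * n1 * (2 * PI * (z1 - z)) <= 2 * n1 * n1 * (2 * PI * (z1 - z)))
          by (apply Rmult_le_compat_r; nra).
        assert (T2 : n1 * n2 * (2 * PI * (z2 - z1)) <= 2 * n1 * n1 * (2 * PI * (z2 - z1)))
          by (apply Rmult_le_compat_r; nra).
        assert (T3 : d * (a1 * a1 + a0 * a0) <= 4 * PI * (z2 - z) * (n1 * n1)) by lra.
        assert (T4 : d * (n1 * n1) <= d * (2 * Q * (a1 * a1 + a0 * a0)))
          by (apply Rmult_le_compat_l; lra).
        assert (T5 : d * (n1 * n1) <= 8 * PI * Q * (z2 - z) * (n1 * n1)).
        { apply Rmult_le_compat_l with (r := 2 * Q) in T3; [|lra]. lra. }
        assert (T6 : d <= 8 * PI * Q * (z2 - z)) by (apply Rmult_le_reg_r with (n1 * n1); nra).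
        unfold g. apply Rmult_le_reg_r with (8 * PI * Q); [lra|].
        unfold Rdiv. rewrite Rmult_assoc, Rinv_l by lra. lra. }
      rewrite S_INR. lra. }
  destruct (H J (Nat.le_refl _)) as [z [Hz Hyz]].
  assert (HJg : 1 / 2 <= INR J * g).
  { unfold g. apply Rmult_le_reg_r with (8 * PI * Q); [lra|].
    replace (INR J * (d / (8 * PI * Q)) * (8 * PI * Q)) with (INR J * d) by (field; lra). lra. }
  rewrite <- Hz.
  assert (A : lift_orbit w (y + 1 / 2) (2 * J) <= lift_orbit w z (2 * J))
    by (apply lift_orbit_le; [intro; lra|lra]).
  pose proof (lift_orbit_half w y 1 (2 * J)) as A2. simpl (IZR 1) in A2. lra.
Qed.

Lemma rho_gain (lambda : R) (f : R -> R) (alpha E d Q : R) (J : nat) :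
  irrational alpha -> (forall x, continuous f x) -> (forall x, f (x + 1) = f x) ->
  0 < d -> 4 * d * Q <= 1 ->
  (forall x k, (k <= 2 * J)%nat ->
     nsq (vec_orbit (potential lambda f alpha E x) (1, 0) k) <= Q /\
     nsq (vec_orbit (potential lambda f alpha E x) (0, 1) k) <= Q) ->
  4 * PI * Q <= INR J * d ->
  rho lambda f alpha E < rho lambda f alpha (E - d).
Proof.
  intros Ha Hc Hp Hd HdQ HQ HJ.
  assert (HJ0 : (0 < J)%nat).
  { destruct J; [|lia]. simpl in HJ. destruct (HQ 0 0%nat ltac:(lia)) as [A _].
    unfold nsq in A; simpl in A. pose proof PI_RGT_0. nra. }
  apply (uniform_rotation_gain lambda f alpha E (E - d) _ _ (2 * J)); try now apply rho_spec.
  - lia.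
  - intros x y. eapply Rle_trans; [apply (lift_gain _ d Q); auto|].
    right. apply lift_orbit_ext. intro j. unfold potential. ring.
Qed.

Lemma mat_vec_Mmult (A B : @matrix C 2 2) (v : C * C) :
  mat_vec (K := C_Ring) (Mmult (T := C_Ring) A B) v
  = mat_vec (K := C_Ring) A (mat_vec (K := C_Ring) B v).
Proof.
  destruct v as [v0 v1], A as [[a b] [[c e] u]], B as [[a' b'] [[c' e'] u']].
  unfold mat_vec, Mmult. rewrite !coeff_mat_bij by lia. simpl Init.Nat.pred.
  rewrite !sum_Sn, !sum_O. unfold plus, mult; simpl.
  apply injective_projections; cbn [fst snd]; ring.
Qed.

Lemma mat_vec_transfer (lambda : R) (f : R -> R) (F : C -> C) (alpha E x a b : R) (k : nat) :
  (forall x, F (RtoC x) = RtoC (f x)) ->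
  mat_vec (K := C_Ring) (transfer lambda F alpha E k (RtoC x)) (RtoC a, RtoC b)
  = (RtoC (fst (vec_orbit (potential lambda f alpha E x) (a, b) k)),
     RtoC (snd (vec_orbit (potential lambda f alpha E x) (a, b) k))).
Proof.
  intros HF. induction k as [|k IH].
  - unfold mat_vec, transfer, Mone. rewrite !coeff_mat_bij by lia. simpl.
    unfold plus, mult, one, zero; simpl.
    apply injective_projections; cbn [fst snd]; ring.
  - cbn [transfer]. rewrite mat_vec_Mmult, IH.
    rewrite <- RtoC_plus. unfold S_cplx. rewrite HF.
    unfold mat_vec, step_matrix, coeff_mat; simpl.
    unfold plus, mult, opp, one, zero; simpl.
    apply injective_projections; cbn [fst snd];
      rewrite ?RtoC_minus, ?RtoC_mult; unfold potential; rewrite ?RtoC_minus, ?RtoC_mult; ring.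
Qed.

Lemma vec_norm_le (v : C * C) : vec_norm v <= Cmod (fst v) + Cmod (snd v).
Proof.
  unfold vec_norm. pose proof (Cmod_ge_0 (fst v)). pose proof (Cmod_ge_0 (snd v)).
  rewrite <- (sqrt_pow2 (Cmod (fst v) + Cmod (snd v))) by lra.
  apply sqrt_le_1_alt. nra.
Qed.

Lemma op_norm_ge (M : @matrix C 2 2) (v : C * C) :
  vec_norm v = 1 -> vec_norm (mat_vec (K := C_Ring) M v) <= op_norm M.
Proof.
  intros Hv. unfold op_norm.
  set (S := fun r => exists v : C * C, vec_norm v = 1 /\ r = vec_norm (mat_vec (K := C_Ring) M v)).
  pose proof (Lub_Rbar_correct S) as [H1 H2].
  assert (A1 : Rbar_le (Finite (vec_norm (mat_vec (K := C_Ring) M v))) (Lub_Rbar S))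
    by (apply H1; exists v; auto).
  set (b := Cmod (coeff_mat zero M 0 0) + Cmod (coeff_mat zero M 0 1)
            + (Cmod (coeff_mat zero M 1 0) + Cmod (coeff_mat zero M 1 1))).
  assert (A2 : Rbar_le (Lub_Rbar S) (Finite b)).
  { apply H2. intros r [u [Hu ->]]. simpl.
    eapply Rle_trans; [apply vec_norm_le|].
    assert (Hu2 : Cmod (fst u) ^ 2 + Cmod (snd u) ^ 2 = 1).
    { unfold vec_norm in Hu. rewrite <- (sqrt_sqrt (Cmod (fst u) ^ 2 + Cmod (snd u) ^ 2)), Hu.
      - ring.
      - pose proof (pow2_ge_0 (Cmod (fst u))). pose proof (pow2_ge_0 (Cmod (snd u))). lra. }
    pose proof (Cmod_ge_0 (fst u)) as C1. pose proof (Cmod_ge_0 (snd u)) as C2.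
    assert (C3 : Cmod (fst u) <= 1) by nra. assert (C4 : Cmod (snd u) <= 1) by nra.
    assert (T : forall x y : C, Cmod (plus (mult x (fst u)) (mult y (snd u))) <= Cmod x + Cmod y).
    { intros x y. eapply Rle_trans; [apply Cmod_triangle|].
      change (Cmod (x * fst u)%C + Cmod (y * snd u)%C <= Cmod x + Cmod y).
      rewrite !Cmod_mult. pose proof (Cmod_ge_0 x). pose proof (Cmod_ge_0 y). nra. }
    unfold b, mat_vec; cbn [fst snd]. apply Rplus_le_compat; apply T. }
  destruct (Lub_Rbar S); simpl in *; tauto.
Qed.

Lemma vec_norm_R (a b : R) : vec_norm (RtoC a, RtoC b) = sqrt (nsq (a, b)).
Proof.
  unfold vec_norm, nsq; cbn [fst snd]. rewrite !Cmod_R, !pow2_abs. f_equal. ring.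
Qed.

Lemma strip_norm_orbit (lambda : R) (f : R -> R) (F : C -> C) (alpha E eta b x : R) (v : R * R) (k : nat) :
  (forall x, F (RtoC x) = RtoC (f x)) -> 0 <= eta -> nsq v = 1 ->
  Rbar_le (strip_norm eta (transfer lambda F alpha E k)) (Finite b) ->
  nsq (vec_orbit (potential lambda f alpha E x) v k) <= b * b.
Proof.
  intros HF Heta Hv Hb. destruct v as [v0 v1].
  assert (H1 : Rbar_le (Finite (op_norm (transfer lambda F alpha E k (RtoC x)))) (Finite b)).
  { eapply Rbar_le_trans; [|exact Hb]. unfold strip_norm.
    match goal with |- Rbar_le _ (Lub_Rbar ?S) => destruct (Lub_Rbar_correct S) as [A _] end.
    apply A. exists (RtoC x). split; [|reflexivity].
    unfold in_strip; simpl. rewrite Rabs_R0. exact Heta. }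
  simpl in H1.
  pose proof (op_norm_ge (transfer lambda F alpha E k (RtoC x)) (RtoC v0, RtoC v1)) as H2.
  rewrite vec_norm_R, Hv, sqrt_1 in H2. specialize (H2 eq_refl).
  rewrite (mat_vec_transfer lambda f F alpha E x v0 v1 k HF), vec_norm_R in H2.
  rewrite <- surjective_pairing in H2.
  set (u := vec_orbit (potential lambda f alpha E x) (v0, v1) k) in *.
  rewrite <- (sqrt_sqrt (nsq u)) by apply nsq_pos.
  pose proof (sqrt_pos (nsq u)). apply Rmult_le_compat; lra.
Qed.

Lemma analytic_extension_continuous (delta : R) (f : R -> R) (F : C -> C) :
  0 <= delta -> analytic_extension delta f F -> forall x, continuous f x.
Proof.
  intros Hd [HF [_ HA]] x.
  assert (Hs : in_strip delta (RtoC x)) by (unfold in_strip; simpl; rewrite Rabs_R0; exact Hd).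
  specialize (HA _ Hs). apply locally_singleton in HA.
  apply ex_derive_continuous in HA.
  apply (continuous_ext (fun t => fst (F (RtoC t)))); [intro t; now rewrite HF|].
  apply (continuous_comp (V := C_NormedModule) (fun t => F (RtoC t)) (fun z : C => fst z));
    [|destruct (F (RtoC x)); apply continuous_fst].
  apply (continuous_comp (V := AbsRing_UniformSpace C_AbsRing) RtoC F); [|exact HA].
  intros P [eps HP]. exists eps. intros t Ht. apply HP.
  change (Cmod (RtoC t - RtoC x)%C < eps). rewrite <- RtoC_minus, Cmod_R. exact Ht.
Qed.

Lemma analytic_extension_periodic (delta : R) (f : R -> R) (F : C -> C) :
  0 <= delta -> analytic_extension delta f F -> forall x, f (x + 1) = f x.
Proof.
  intros Hd [HF [HP _]] x. apply RtoC_inj. rewrite <- !HF, RtoC_plus. apply HP.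
  unfold in_strip; simpl. rewrite Rabs_R0. exact Hd.
Qed.

(** * The gap estimate *)

Lemma nat_floor (t : R) : 0 <= t -> exists J : nat, INR J <= t < INR J + 1.
Proof.
  intros Ht. destruct (nfloor_ex t Ht) as [J HJ]. now exists J.
Qed.

(* With X = exp (eta n / 6) the three quantities compared are d = X^-2,
   Q = Cs^2 X and J ~ X^6 / 2. *)
Lemma gap_parameters (Cs b X : R) :
  1 <= Cs -> 64 * Cs ^ 2 <= X -> 0 <= b * b <= Cs ^ 2 * X ->
  exists J : nat, INR (2 * J) <= X ^ 6 /\
    4 * / X ^ 2 * (b * b) <= 1 /\ 4 * PI * (b * b) <= INR J * / X ^ 2.
Proof.
  intros HC HX Hb.
  assert (HC2 : 1 <= Cs ^ 2) by nra.
  assert (HX0 : 64 <= X) by lra.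
  destruct (nat_floor (X ^ 6 / 2)) as [J [HJ1 HJ2]].
  { apply Rdiv_le_0_compat; [apply pow_le; lra|lra]. }
  exists J. split; [rewrite mult_INR; simpl (INR 2); lra|].
  assert (HX2 : 0 < X ^ 2) by (apply pow_lt; lra).
  assert (H1 : X <= X ^ 2) by nra.
  assert (H6 : X ^ 6 = X ^ 2 * (X ^ 2 * X ^ 2)) by ring.
  split.
  - apply Rmult_le_reg_r with (X ^ 2); [exact HX2|].
    replace (4 * / X ^ 2 * (b * b) * X ^ 2) with (4 * (b * b)) by (field; lra).
    assert (64 * Cs ^ 2 * X <= X * X) by (apply Rmult_le_compat_r; lra).
    nra.
  - apply Rmult_le_reg_r with (X ^ 2); [exact HX2|].
    replace (INR J * / X ^ 2 * X ^ 2) with (INR J) by (field; lra).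
    pose proof PI_4 as HPI. pose proof PI_RGT_0.
    assert (A1 : 4 * PI * (b * b) * X ^ 2 <= 16 * (Cs ^ 2 * X) * X ^ 2).
    { apply Rmult_le_compat_r; [lra|]. apply Rmult_le_compat; lra. }
    assert (A2 : 64 * Cs ^ 2 * (X * X ^ 2) <= X * (X * X ^ 2)) by (apply Rmult_le_compat_r; nra).
    assert (A3 : X * (X * X ^ 2) = X ^ 2 * X ^ 2) by ring.
    assert (A4 : X ^ 2 * X ^ 2 * 4096 <= X ^ 2 * X ^ 2 * X ^ 2)
      by (apply Rmult_le_compat_l; nra).
    assert (A5 : 1 <= X ^ 2 * X ^ 2) by nra.
    lra.
Qed.

Theorem theorem5p1 :
  forall C0 : R, 0 < C0 ->
  exists C1min C2min : R, 0 < C1min /\ 0 < C2min /\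
  forall C1 C2 : R, C1min <= C1 -> C2min <= C2 ->
  forall (alpha eta : R) (f : R -> R) (F : C -> C),
    irrational alpha ->
    Rbar_le (Finite 0) (beta alpha) -> Rbar_lt (beta alpha) p_infty ->
    C1 * real (beta alpha) < eta ->
    analytic_extension (C2 * eta) f F ->
  forall (theta : R -> R -> R) (u : R -> R -> Z -> C) (lambda0 : R),
    (forall lambda : R, 0 < Rabs lambda <= lambda0 ->
       is_dual_choice lambda f alpha (theta lambda) (u lambda)) ->
    is_LY_threshold C0 f F alpha eta theta u lambda0 ->
  forall lambda : R, 0 < Rabs lambda <= lambda0 ->
  exists mstar : R,
  forall m : Z, m <> 0%Z -> mstar <= IZR (Z.abs m) ->
  exists n : nat,
    is_resonance_index alpha (theta lambda (E_plus lambda f alpha m)) n /\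
    E_plus lambda f alpha m - E_minus lambda f alpha m <= exp (- (eta / 3) * INR n).
Proof.
  intros C0 HC0. exists (12 * C0), 1. split; [lra|]. split; [lra|].
  intros C1 C2 HC1 HC2 alpha eta f F Ha Hb0 Hb1 Heta HF theta u lambda0 _ [_ HLY] lambda Hl.
  assert (Hb : 0 <= real (beta alpha)).
  { destruct (beta alpha); simpl in *; try lra; tauto. }
  set (b := real (beta alpha)) in *.
  assert (Heta12 : 12 * C0 * b < eta) by nra.
  assert (Heta0 : 0 < eta) by nra.
  assert (Hstrip : 0 <= C2 * eta) by nra.
  pose proof (analytic_extension_continuous _ f F Hstrip HF) as Hc.
  pose proof (analytic_extension_periodic _ f F Hstrip HF) as Hp.
  destruct (HLY lambda Hl) as [Cstar [M HE]].
  set (Cs := Rmax Cstar 1).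
  assert (HCs : 1 <= Cs) by apply Rmax_r.
  exists (Rmax (M + 1) (C0 * (6 * (64 * Cs ^ 2) / eta))). intros m Hm Hmm.
  assert (HmM : M < IZR (Z.abs m)) by (pose proof (Rmax_l (M + 1) (C0 * (6 * (64 * Cs ^ 2) / eta))); lra).
  assert (HmC : C0 * (6 * (64 * Cs ^ 2) / eta) <= IZR (Z.abs m))
    by (eapply Rle_trans; [apply Rmax_r|exact Hmm]).
  destruct (gap_edges lambda f alpha m Ha Hc Hp Hm) as [Hgap [Hdec Hlen]].
  set (Ep := E_plus lambda f alpha m) in *.
  assert (HS : Sigma lambda f alpha Ep) by now apply Sigma_of_rho_decreasing.
  destruct (HE Ep m HS Hgap) as [n [Hn [HnC [_ HK]]]].
  exists n. split; [exact Hn|]. apply Hlen.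
  assert (HnL : 6 * (64 * Cs ^ 2) / eta <= INR n).
  { apply Rmult_le_reg_l with C0; [exact HC0|].
    apply Rle_trans with (IZR (Z.abs m)); [exact HmC|now apply HnC]. }
  set (t := eta * INR n / 6).
  assert (Ht : 64 * Cs ^ 2 <= t).
  { unfold t. apply Rmult_le_compat_l with (r := eta / 6) in HnL; [|lra].
    replace (eta / 6 * (6 * (64 * Cs ^ 2) / eta)) with (64 * Cs ^ 2) in HnL by (field; lra).
    lra. }
  assert (Ht0 : 0 < t) by nra.
  set (X := exp t).
  assert (HX : 64 * Cs ^ 2 <= X).
  { unfold X. pose proof (exp_ineq1 t ltac:(lra)). lra. }
  assert (HXpow : forall k : nat, X ^ k = exp (INR k * t)).
  { induction k as [|k IH]; [simpl; rewrite Rmult_0_l, exp_0; reflexivity|].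
    rewrite S_INR. cbn [pow]. rewrite IH. unfold X. rewrite <- exp_plus. f_equal. ring. }
  assert (Ed : exp (- (eta / 3) * INR n) = / X ^ 2).
  { rewrite HXpow, <- exp_Ropp. f_equal. unfold t. simpl. field. }
  set (B := Cs * exp (C0 * b * INR n)).
  assert (HB : 0 <= B * B <= Cs ^ 2 * X).
  { split; [apply Rle_0_sqr|]. unfold B.
    replace (Cs * exp (C0 * b * INR n) * (Cs * exp (C0 * b * INR n)))
      with (Cs ^ 2 * (exp (C0 * b * INR n) * exp (C0 * b * INR n))) by ring.
    apply Rmult_le_compat_l; [nra|]. rewrite <- exp_plus. unfold X, t.
    pose proof (pos_INR n) as Hn0.
    destruct (Req_dec (INR n) 0) as [->|Hn1]; [right; f_equal; field|].
    left. apply exp_increasing. nra. }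
  destruct (gap_parameters Cs B X HCs HX HB) as [J [HJ1 [HJ2 HJ3]]].
  rewrite Ed. apply (rho_gain lambda f alpha Ep (/ X ^ 2) (B * B) J); auto.
  - apply Rinv_0_lt_compat, pow_lt. unfold X. apply exp_pos.
  - intros x k Hk.
    assert (HKk : Rbar_le (strip_norm eta (transfer lambda F alpha Ep k)) (Finite B)).
    { eapply Rbar_le_trans.
      - apply HK. apply le_INR in Hk.
        replace (eta * INR n) with (INR 6 * t) by (unfold t; simpl; field).
        rewrite <- HXpow. lra.
      - simpl. unfold B. apply Rmult_le_compat_r; [left; apply exp_pos|apply Rmax_l]. }
    destruct HF as [HFr _].
    split; apply (strip_norm_orbit lambda f F alpha Ep eta B x _ k HFr); auto; try lra;
      unfold nsq; simpl; ring.
Qed.
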